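(* Let $\zeta\in S_\infty$ have rank $n$ in the Grassmannian-Bruhat order, let $\mathcal{C}$ be the set of chains in $[e,\zeta]_\preceq$ with descent map $\mathrm{Des}$, and for $2\leq i\leq n-1$ let $\varphi_i$ be the involution on $\mathcal{C}$ defined below. Then $\{\varphi_i\mid 2\leq i\leq n-1\}$ is a dual equivalence for $(\mathcal{C},\mathrm{Des})$.
   Context: Grassmannian-Bruhat order: $S_\infty$ is the group of permutations of $\{1,2,\dotsc\}$ moving finitely many points, $e$ its identity, $t_{ab}$ ($a<b$) a transposition. For $\zeta\in S_\infty$ let $\mathrm{up}(\zeta)=\{a\mid a<\zeta(a)\}$, $\mathrm{dw}(\zeta)=\{b\mid b>\zeta(b)\}$. Then $\eta\preceq\zeta$ iff (1) for all $a\in\mathrm{up}(\zeta)$, $a\leq\eta(a)\leq\zeta(a)$; (2) for all $b\in\mathrm{dw}(\zeta)$, $b\geq\eta(b)\geq\zeta(b)$; (3) for all $a<b$ with $a,b\in\mathrm{up}(\zeta)$ or $a,b\in\mathrm{dw}(\zeta)$, $\zeta(a)<\zeta(b)$ implies $\eta(a)<\eta(b)$. This is a ranked poset; for a cover $\eta\prec\zeta$, $\zeta\eta^{-1}=t_{ab}$ is a transposition ($a<b$), labeled $b$. $\zeta$ has rank $n$ if $[e,\zeta]_\preceq$ has rank $n$. A chain in $[e,\zeta]_\preceq$ is a sequence $(t_{a_1b_1},\dotsc,t_{a_nb_n})$ ($a_j<b_j$) with $\eta_0=e$, $\eta_j=t_{a_jb_j}\cdots t_{a_1b_1}$, each $\eta_{j-1}\prec\eta_j$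 a cover, $\eta_n=\zeta$; $\mathrm{Des}(c)=\{j\in[n-1]\mid b_j>b_{j+1}\}$. Transpositions $t_{\alpha\beta},t_{\gamma\delta}$ are disjoint if $\beta<\gamma$, $\delta<\alpha$, $\alpha<\gamma<\delta<\beta$, or $\gamma<\alpha<\beta<\delta$. The involutions: $\varphi_i(c)=c$ if $c$ has descents at both $i-1$ and $i$ or at neither. Otherwise $\varphi_i(c)$ is obtained by replacing the three transpositions of $c$ in positions $i-1,i,i+1$ according to the following interchanges (all other entries unchanged): (A) $(t_{\beta\gamma},t_{\alpha\beta},t_{\beta\delta})\leftrightarrow(t_{\alpha\gamma},t_{\gamma\delta},t_{\beta\gamma})$ and $(t_{\beta\delta},t_{\alpha\beta},t_{\beta\gamma})\leftrightarrow(t_{\beta\gamma},t_{\gamma\delta},t_{\alpha\gamma})$ for $\alpha<\beta<\gamma<\delta$; (B) $(t_{b\beta},t_{a\alpha},t_{c\gamma})\leftrightarrow(t_{b\beta},t_{c\gamma},t_{a\alpha})$ and $(t_{c\gamma},t_{a\alpha},t_{b\beta})\leftrightarrow(t_{a\alpha},t_{c\gamma},t_{b\beta})$ for $a<\alpha$, $b<\beta$, $c<\gamma$, $\alpha<\beta<\gamma$ with $t_{a\alpha},t_{c\gamma}$ disjoint; (C) $(t_{pq},t_{\alpha\beta},t_{\beta\gamma})\leftrightarrow(t_{\alpha\beta},t_{\beta\gamma},t_{pq})$ and $(t_{\beta\gamma},t_{\alpha\beta},t_{pq})\leftrightarrow(t_{pq},t_{\beta\gamma},t_{\alpha\beta})$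 for $\alpha<\beta<p<q<\gamma$. Quasisymmetric functions: for $D\subset[m-1]$, $Q_D=\sum x_{i_1}\cdots x_{i_m}$ over $i_1\leq\dotsb\leq i_m$ with $i_j<i_{j+1}$ for $j\in D$. Dual equivalence: for a finite set $\mathcal{C}$, a map $\mathrm{Des}\colon\mathcal{C}\to 2^{[n-1]}$ ($c$ has a descent at $j$ if $j\in\mathrm{Des}(c)$), a family of involutions $\{\varphi_i\}_{2\leq i\leq n-1}$ on $\mathcal{C}$ is a dual equivalence if: (i) the fixed points of $\varphi_i$ are exactly those $c$ with descents at both or neither of $i-1,i$; (ii) for $c\neq\varphi_i(c)$: (a) $c$ and $\varphi_i(c)$ have the same descents except possibly in $\{i-2,i-1,i,i+1\}$; (b) for each $j\in\{i-1,i\}$ exactly one of $c,\varphi_i(c)$ has a descent at $j$; (c) if exactly one of $c,\varphi_i(c)$ has a descent at $i-2$, then $c\neq\varphi_{i-1}(c)$; (d) if exactly one of $c,\varphi_i(c)$ has a descent at $i+1$, then $c\neq\varphi_{i+1}(c)$; (iii) $\varphi_i\varphi_j=\varphi_j\varphi_i$ whenever $|i-j|\geq3$; For $2\leq i<j\leq n-1$: $\mathrm{Des}_{(i,j)}(c)$ is obtained by intersecting $\mathrm{Des}(c)$ with $\{i-1,\dotsc,j\}$ and subtracting $i-2$ from each element (a subset of $[j-i+2]$, used with $Q$ of degree $j-i+3$); $\sim_{(i,j)}$ is the equivalence relation generated by $c\sim\varphi_k(c)$ for $i\leq k\leq j$, and $[c]_{(i,j)}$ the class of $c$. (iv.a)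 for all $i<j\leq i+2$ and $c\in\mathcal{C}$, $\sum_{a\in[c]_{(i,j)}}Q_{\mathrm{Des}_{(i,j)}(a)}$ is symmetric and Schur-positive; (iv.b) for every $3\leq i\leq n-1$ and $c$ not fixed by $\varphi_i$ such that neither $c$ nor $\varphi_i(c)$ is fixed by $\varphi_{i-1}$ or $\varphi_{i+1}$, $\sum_{a\in[c]_{(i-1,i)}}Q_{\mathrm{Des}_{(i-1,i)}(a)}=\sum_{a\in[c]_{(i,i+1)}}Q_{\mathrm{Des}_{(i,i+1)}(a)}$; (iv.c) a flat $i$-chain is a list $c_1,\dotsc,c_{2r}$ of distinct elements with: no $c_j$ fixed by $\varphi_{i-2}$ or $\varphi_i$, and each of $c_3,c_5,\dotsc,c_{2r-1}$ fixed by $\varphi_{i-1}$; $\varphi_i(c_{2j-1})=c_{2j}$ for $j=1,\dotsc,r$; and for $j=1,\dotsc,r-1$, $c_{2j+1}=(\varphi_{i-2}\circ\varphi_{i-1})^t\circ\varphi_{i-2}(c_{2j})$ for some $t\geq0$. Condition: for each $3<i<n-1$ and every flat $i$-chain $c_1,\dotsc,c_{2r}$, if for some $1<j<r$ neither $c_{2j-1}$ nor $c_{2j}$ is fixed by $\varphi_{i+1}$, then either none of $c_1,\dotsc,c_{2j}$ is fixed by $\varphi_{i+1}$ or none of $c_{2j-1},\dotsc,c_{2r}$ is fixed by $\varphi_{i+1}$. The same condition is also required for the family $\psi_i:=\varphi_{n+1-i}$ ($2\leq i\leq n-1$) with descent map $c\mapsto\{n-j\mid j\in\mathrm{Des}(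c)\}$.
   Formalization: The order η⪯ζ also requires η(a)=a whenever ζ(a)=a (otherwise every η satisfies e⪯η⪯e and ⪯ is not a partial order); condition (iv.b) is stated for 3≤i≤n-2, since φ_{i+1} does not exist for i=n-1. *)

(* Defs.v *)
From Stdlib Require Relation_Operators.
From mathcomp Require Import all_boot all_order all_algebra.
From mathcomp Require Import finmap multiset.
From mathcomp Require Import all_classical.

Set Implicit Arguments.
Unset Strict Implicit.
Unset Printing Implicit Defensive.

Import GRing.Theory.

Local Open Scope classical_set_scope.
Local Open Scope nat_scope.

Definition exactly_one (P Q : Prop) : Prop := (P /\ ~ Q) \/ (~ P /\ Q).

(** * Symmetric and quasisymmetric functions *)

(* The letters permuted by S_oo, and the indices of the variables, are
   {0, 1, ...} instead of {1, 2, ...}; only their order matters. *)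
Definition Sinf : set (nat -> nat) :=
  [set f | bijective f /\ finite_set [set x | f x <> x]].

(* A formal power series in the x_k (k : nat) with integer coefficients, as the
   function sending a monomial (a finite multiset of indices) to its
   coefficient. *)
Notation fseries := ({mset nat}%mset -> int).

(* The sum of x_{w_1} ... x_{w_m} over the words w = w_1 ... w_m satisfying P:
   the words whose monomial is M are the rearrangements of M. *)
Definition word_series (P : pred (seq nat)) : fseries :=
  fun M => Posz (count P (permutations M)).

(* [w] is indexed from 0, so that its j-th letter is [nth 0 w j.-1]. *)
Definition Q (m : nat) (D : set nat) : fseries :=
  word_series (fun w =>
    [&& size w == m, sorted leq w &
        all (fun j => (j \in D) ==> (nth 0 w j.-1 < nth 0 w j)) (iota 1 m.-1)]).

Definition is_partition (la : seq nat) : bool :=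
  sorted geq la && all (leq 1) la.

(* A filling is the sequence of its rows. *)
Definition semistandard (T : seq (seq nat)) : bool :=
  all (sorted leq) T &&
  all (fun r => all (fun k => nth 0 (nth [::] T r) k < nth 0 (nth [::] T r.+1) k)
                    (iota 0 (size (nth [::] T r.+1))))
      (iota 0 (size T).-1).

(* A filling of shape la is encoded by the concatenation of its rows. *)
Definition schur (la : seq nat) : fseries :=
  word_series (fun w => (size w == sumn la) && semistandard (reshape la w)).

Definition is_symmetric (f : fseries) : Prop :=
  forall s, Sinf s -> forall M : {mset nat}%mset,
    f (seq_mset (map s M)) = f M.

Definition schur_positive (f : fseries) : Prop :=
  exists (P : seq (seq nat)) (k : seq nat -> nat),
    all is_partition P /\ f = (\sum_(la <- P) schur la *+ k la)%R.

(** * Dual equivalence *)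

Section DualEquivalence.

Variables (T : choiceType) (n : nat) (C : set T).
Variables (Des : T -> set nat) (phi : nat -> T -> T).

Definition Des_ij (i j : nat) (c : T) : set nat :=
  [set k - (i - 2) | k in Des c `&` [set k | i - 1 <= k <= j]].

(* The generating relation is restricted to C because [phi] is a total function
   on T, of which only the values on C matter. *)
Definition class_ij (i j : nat) (c : T) : set T :=
  [set a | Relation_Operators.clos_refl_sym_trans T
             (fun x y => C x /\ exists2 k, i <= k <= j & y = phi k x) c a].

Definition class_series (i j : nat) (c : T) : fseries :=
  (\sum_(a \in class_ij i j c) Q (j - i + 3) (Des_ij i j a))%R.

(* The list c_1, ..., c_{2r} is given by the values of [c] on [1, 2r]. *)
Definition flat_chain (ph : nat -> T -> T) (i r : nat) (c : nat -> T) : Prop :=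
  [/\ forall k, 1 <= k <= 2 * r ->
        [/\ C (c k), ph (i - 2) (c k) <> c k & ph i (c k) <> c k],
      forall k l, 1 <= k <= 2 * r -> 1 <= l <= 2 * r -> c k = c l -> k = l,
      forall j, 2 <= j <= r -> ph (i - 1) (c (2 * j - 1)) = c (2 * j - 1),
      forall j, 1 <= j <= r -> ph i (c (2 * j - 1)) = c (2 * j) &
      forall j, 1 <= j <= r - 1 -> exists t,
        c (2 * j + 1) =
        iter t (fun x => ph (i - 2) (ph (i - 1) x)) (ph (i - 2) (c (2 * j)))].

Definition flat_chain_condition (ph : nat -> T -> T) : Prop :=
  forall i r c, 3 < i < n - 1 -> flat_chain ph i r c ->
  forall j, 1 < j < r ->
    ph i.+1 (c (2 * j - 1)) <> c (2 * j - 1) ->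
    ph i.+1 (c (2 * j)) <> c (2 * j) ->
    (forall k, 1 <= k <= 2 * j -> ph i.+1 (c k) <> c k) \/
    (forall k, 2 * j - 1 <= k <= 2 * r -> ph i.+1 (c k) <> c k).

Definition setting : Prop :=
  [/\ finite_set C,
      forall c, C c -> Des c `<=` [set j | 1 <= j <= n - 1] &
      forall i c, 2 <= i <= n - 1 -> C c -> C (phi i c) /\ phi i (phi i c) = c].

Definition axiom_i : Prop :=
  forall i c, 2 <= i <= n - 1 -> C c ->
    (phi i c = c <-> (Des c (i - 1) <-> Des c i)).

Definition axiom_ii : Prop :=
  forall i c, 2 <= i <= n - 1 -> C c -> c <> phi i c ->
    [/\ forall j, j \notin [:: i - 2; i - 1; i; i + 1] ->
          (Des c j <-> Des (phi i c) j),
        forall j, j \in [:: i - 1; i] ->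
          exactly_one (Des c j) (Des (phi i c) j),
        exactly_one (Des c (i - 2)) (Des (phi i c) (i - 2)) ->
          c <> phi (i - 1) c &
        exactly_one (Des c (i + 1)) (Des (phi i c) (i + 1)) ->
          c <> phi (i + 1) c].

Definition axiom_iii : Prop :=
  forall i j c, 2 <= i <= n - 1 -> 2 <= j <= n - 1 ->
    (i + 3 <= j) || (j + 3 <= i) -> C c -> phi i (phi j c) = phi j (phi i c).

Definition axiom_iva : Prop :=
  forall i j c, 2 <= i -> i < j <= i + 2 -> j <= n - 1 -> C c ->
    is_symmetric (class_series i j c) /\ schur_positive (class_series i j c).

(* Here i + 1 <= n - 1, since phi_{i+1} is involved. *)
Definition axiom_ivb : Prop :=
  forall i c, 3 <= i -> i + 1 <= n - 1 -> C c -> phi i c <> c ->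
    phi (i - 1) c <> c -> phi (i + 1) c <> c ->
    phi (i - 1) (phi i c) <> phi i c -> phi (i + 1) (phi i c) <> phi i c ->
    class_series (i - 1) i c = class_series i (i + 1) c.

(* The reversed descent map does not occur because the condition on flat chains
   does not involve descents. *)
Definition axiom_ivc : Prop :=
  flat_chain_condition phi /\ flat_chain_condition (fun i => phi (n + 1 - i)).

Definition dual_equivalence : Prop :=
  [/\ setting, axiom_i, axiom_ii & axiom_iii] /\
  [/\ axiom_iva, axiom_ivb & axiom_ivc].

End DualEquivalence.

(** * The Grassmannian-Bruhat order *)

Definition up (z : nat -> nat) : set nat := [set a | a < z a].
Definition dw (z : nat -> nat) : set nat := [set b | z b < b].

(* The second clause is usually left implicit: without it the fixed points of z
   would be unconstrained, and the relation would not be antisymmetric. *)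
Definition gb_le (y z : nat -> nat) : Prop :=
  [/\ forall a, up z a -> a <= y a <= z a,
      forall a, z a = a -> y a = a,
      forall b, dw z b -> z b <= y b <= b &
      forall a b, a < b -> (up z a /\ up z b) \/ (dw z a /\ dw z b) ->
        z a < z b -> y a < y b].

Definition gb_lt (y z : nat -> nat) : Prop := gb_le y z /\ y <> z.

Definition gb_cover (y z : nat -> nat) : Prop :=
  [/\ Sinf y, Sinf z, gb_lt y z &
      ~ exists2 x, Sinf x & gb_lt y x /\ gb_lt x z].

(* All the maximal chains of the interval [e, z] have n steps. *)
Definition has_rank (z : nat -> nat) (n : nat) : Prop :=
  forall m, (exists y : nat -> (nat -> nat),
               [/\ y 0 = id, y m = z & forall j, j < m -> gb_cover (y j) (y j.+1)])
            <-> m = n.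

(** * Chains and the involutions *)

(* The transposition t_{ab}, a < b, is encoded by the pair (a, b). *)
Notation transp := (nat * nat)%type.

Definition transp_fun (t : transp) (x : nat) : nat :=
  if x == t.1 then t.2 else if x == t.2 then t.1 else x.

(* t_m ... t_1 for c = [:: t_1; ...; t_m] *)
Definition chain_perm (c : seq transp) : nat -> nat :=
  foldl (fun y t => transp_fun t \o y) id c.

Definition is_chain (z : nat -> nat) (n : nat) (c : seq transp) : Prop :=
  [/\ size c = n,
      forall t, t \in c -> t.1 < t.2,
      forall j, j < n -> gb_cover (chain_perm (take j c)) (chain_perm (take j.+1 c)) &
      chain_perm c = z].

Definition chains (z : nat -> nat) (n : nat) : set (seq transp) :=
  [set c | is_chain z n c].

(* b_j, for j counted from 1 *)
Definition label (c : seq transp) (j : nat) : nat := (nth (0, 0) c j.-1).2.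

Definition chain_Des (c : seq transp) : set nat :=
  [set j | 1 <= j <= size c - 1 /\ label c j > label c j.+1].

Definition disjoint_transp (t u : transp) : bool :=
  [|| t.2 < u.1, u.2 < t.1,
      (t.1 < u.1) && (u.2 < t.2) | (u.1 < t.1) && (t.2 < u.2)].

Inductive interchange : seq transp -> seq transp -> Prop :=
| interchange_A1 al be ga de : al < be < ga -> ga < de ->
    interchange [:: (be, ga); (al, be); (be, de)] [:: (al, ga); (ga, de); (be, ga)]
| interchange_A2 al be ga de : al < be < ga -> ga < de ->
    interchange [:: (be, de); (al, be); (be, ga)] [:: (be, ga); (ga, de); (al, ga)]
| interchange_B1 a al b be c ga : a < al -> b < be -> c < ga -> al < be < ga ->
    disjoint_transp (a, al) (c, ga) ->
    interchange [:: (b, be); (a, al); (c, ga)] [:: (b, be); (c, ga); (a, al)]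
| interchange_B2 a al b be c ga : a < al -> b < be -> c < ga -> al < be < ga ->
    disjoint_transp (a, al) (c, ga) ->
    interchange [:: (c, ga); (a, al); (b, be)] [:: (a, al); (c, ga); (b, be)]
| interchange_C1 al be p q ga : al < be < p -> p < q < ga ->
    interchange [:: (p, q); (al, be); (be, ga)] [:: (al, be); (be, ga); (p, q)]
| interchange_C2 al be p q ga : al < be < p -> p < q < ga ->
    interchange [:: (be, ga); (al, be); (p, q)] [:: (p, q); (be, ga); (al, be)]
| interchange_sym u v : interchange u v -> interchange v u.

(* The interchanges apply to the entries in positions i-1, i, i+1. *)
Definition interchange_at (i : nat) (c d : seq transp) : Prop :=
  exists s u v s', [/\ size s = i - 2, c = s ++ u ++ s', d = s ++ v ++ s' &
                       interchange u v].

(* At most one d satisfies [interchange_at i c d]; if there were none, [xget]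
   would return c, contradicting the description of the fixed points of phi_i. *)
Definition chain_phi (i : nat) (c : seq transp) : seq transp :=
  if (i - 1 \in chain_Des c) == (i \in chain_Des c) then c
  else xget c [set d | interchange_at i c d].

(* Main.v *)
(* If x <= yx <= zx in the Grassmannian-Bruhat order then y <= z, and conversely
   x <= zx and y <= z imply x <= yx <= zx. Hence the words of transpositions with
   increasing partial products are closed under taking factors and under replacing a
   factor by another such word with the same product; when z has rank n, every such
   word of length n with product z is a maximal chain, since it cannot be refined.
   All the conditions thus concern at most five consecutive entries of a chain (for
   flat chains also the label of a sixth entry, which does not change). Up to an
   increasing relabelling of the letters there are 29400 words of length five with
   increasing partial products, and the conditions are checked on each of them. The
   symmetric functions occurring in (iv.a) have degree at most five, so their Schur
   expansions are verified by comparing coefficients, one for each composition. *)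

Require Import Defs.
From mathcomp Require Import all_boot all_order all_algebra.
From mathcomp Require Import finmap multiset.
From mathcomp Require Import all_classical.
From mathcomp Require Import zify.

Set Implicit Arguments.
Unset Strict Implicit.
Unset Printing Implicit Defensive.

Local Open Scope classical_set_scope.
Local Open Scope nat_scope.

(** * The order *)

(** What makes the check finite is that a transposition [t_ab] may be appended or not according to
    the non-fixed points of the partial product: a fixed point whose letter is neither a nor b
    imposes no condition. The state carried along a word is thus a finite list of pairs of letters,
    and every test performed on it compares letters, hence commutes with increasing relabellings.
    Five is the number of entries on which three consecutive involutions act. Flat chains involve a
    fourth one, phi_(i+1), but only through the question whether it fixes a chain, that is, whether
    two adjacent descents agree. One of these lies in the window of five entries; the other compares
    the label at the end of the window with that of a neighbour which stays constant along the flat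
    chain. This neighbour enters only as a threshold for labels, and a threshold has finitely many
    positions relative to the labels that occur. In this way words of length six need not be
    enumerated. *)

(** With one clause per point, in three exclusive cases, the lemmas on the order become case
    analyses followed by linear arithmetic. *)
Lemma gb_leP (y z : nat -> nat) : gb_le y z <->
  (forall a, [\/ a < z a /\ a <= y a <= z a, z a = a /\ y a = a |
              z a < a /\ z a <= y a <= a]) /\
  (forall a b, a < b -> a < z a /\ b < z b \/ z a < a /\ z b < b ->
     z a < z b -> y a < y b).
Proof.
split=> [[yu yf yd ym]|[yt ym]].
  split=> // a; case: (ltngtP a (z a)) => [az|za|az].
  - by apply: Or31; split=> //; exact: yu.
  - by apply: Or33; split=> //; exact: yd.
  - by apply: Or32; split=> //; apply: yf.
by split=> // a; have := yt a; rewrite /up /dw /=; case=> -[]; lia.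
Qed.

Lemma gb_le_trans (x y z : nat -> nat) : gb_le x y -> gb_le y z -> gb_le x z.
Proof.
move=> /gb_leP[xt xm] /gb_leP[yt ym]; apply/gb_leP; split=> [a|a b ab zab zz].
  by have := xt a; have := yt a; case=> -[yz ay]; case=> -[xy ax];
    (apply: Or31; lia) || (apply: Or32; lia) || (apply: Or33; lia).
have := ym _ _ ab zab zz; have := xm a b ab.
have := xt a; have := yt a; have := xt b; have := yt b.
by case=> -[? ?]; case=> -[? ?]; case=> -[? ?]; case=> -[? ?]; lia.
Qed.

(** The bounds at [v = x a] hold because [a], [x a], [y (x a)], [z (x a)] form a monotone sequence.
    In the last clause the preimages of [v < w] may be in the opposite order; then [y w < y v]
    would, by x <= yx, force [w < v]. *)
Lemma gb_le_quot (x y z : nat -> nat) : bijective x -> injective y ->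
  gb_le x (y \o x) -> gb_le (y \o x) (z \o x) -> gb_le y z.
Proof.
move=> [x' xK x'K] yI /gb_leP[/= xt xm] /gb_leP[/= yt ym]; apply/gb_leP.
have xS v : exists a, x a = v by exists (x' v); rewrite x'K.
split=> [v|v w].
  case: (xS v) => a <-; have [?|?|?] := ltngtP (x a) (z (x a));
    have := xt a; have := yt a;
  case=> -[? ?]; case=> -[? ?];
    (apply: Or31; lia) || (apply: Or32; lia) || (apply: Or33; lia).
case: (xS v) (xS w) => a <- [b <-] => ab zab zz.
have [eab|nab] := eqVneq a b; first by move: ab; rewrite eab; lia.
have [/yI/(can_inj xK)eyab|nyab] := eqVneq (y (x a)) (y (x b)).
  by rewrite eyab eqxx in nab.
have := xm a b; have := ym a b; have := xm b a.
have := xt a; have := yt a; have := xt b; have := yt b.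
by case=> -[? ?]; case=> -[? ?]; case=> -[? ?]; case=> -[? ?]; lia.
Qed.

(** The order clause of x <= yx follows from that of x <= zx if [z] does not invert [x a] and [x b].
    If it does, [x b < x a] would, by y <= z, give [y (x b) < y (x a)]. *)
Lemma gb_le_shift (x y z : nat -> nat) : injective x -> injective z -> injective y ->
  gb_le x (z \o x) -> gb_le y z -> gb_le x (y \o x) /\ gb_le (y \o x) (z \o x).
Proof.
move=> xI zI yI /gb_leP[/= xt xm] /gb_leP[/= yt ym].
split; apply/gb_leP=> /=; split=> [a|a b ab zab zz].
- have [?|?|?] := ltngtP a (y (x a)); have := xt a; have := yt (x a);
  case=> -[? ?]; case=> -[? ?];
    (apply: Or31; lia) || (apply: Or32; lia) || (apply: Or33; lia).
- have [/xI eab|nab] := eqVneq (x a) (x b); first by move: ab; rewrite eab; lia.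
  have [/zI/xI eab|nzab] := eqVneq (z (x a)) (z (x b)).
    by move: ab; rewrite eab; lia.
  have := xm a b; have := ym (x a) (x b); have := ym (x b) (x a).
  have := xt a; have := yt (x a); have := xt b; have := yt (x b).
  by case=> -[? ?]; case=> -[? ?]; case=> -[? ?]; case=> -[? ?]; lia.
- have := xt a; have := yt (x a).
  by case=> -[? ?]; case=> -[? ?];
    (apply: Or31; lia) || (apply: Or32; lia) || (apply: Or33; lia).
- have := xm a b ab zab zz; have := ym (x a) (x b).
  have := xt a; have := yt (x a); have := xt b; have := yt (x b).
  by case=> -[? ?]; case=> -[? ?]; case=> -[? ?]; case=> -[? ?]; lia.
Qed.

Lemma transp_funK t : involutive (transp_fun t).
Proof.
move=> x; rewrite /transp_fun.
case: (x =P t.1) => [->|/eqP/negPf x1]; first by rewrite eqxx; case: eqP.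
case: (x =P t.2) => [->|/eqP/negPf x2]; first by rewrite eqxx.
by rewrite x1 x2.
Qed.

Lemma chain_perm_foldl (y : nat -> nat) (c : seq (nat * nat)) :
  foldl (fun y t => transp_fun t \o y) y c = chain_perm c \o y.
Proof.
rewrite /chain_perm; elim: c y => [|t c IHc] y //=.
by rewrite IHc [in RHS]IHc.
Qed.

Lemma chain_perm_cons t c : chain_perm (t :: c) = chain_perm c \o transp_fun t.
Proof. by rewrite /chain_perm /= chain_perm_foldl. Qed.

Lemma chain_perm_cat c d : chain_perm (c ++ d) = chain_perm d \o chain_perm c.
Proof. by rewrite /chain_perm foldl_cat chain_perm_foldl. Qed.

Lemma chain_perm_bij c : bijective (chain_perm c).
Proof.
elim: c => [|t c IHc]; first exact: (Bijective (fun=> erefl) (fun=> erefl)).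
by rewrite chain_perm_cons; apply: (bij_comp IHc); exact: inv_bij (transp_funK t).
Qed.

Lemma chain_perm_inj c : injective (chain_perm c).
Proof. exact: bij_inj (chain_perm_bij c). Qed.

(** * Words of transpositions whose partial products increase *)

Fixpoint gb_steps (y : nat -> nat) (c : seq (nat * nat)) : Prop :=
  if c is t :: c' then
    [/\ t.1 < t.2, gb_le y (transp_fun t \o y) & gb_steps (transp_fun t \o y) c']
  else True.

Definition gb_word := gb_steps id.

Lemma gb_steps_cat y c d :
  gb_steps y (c ++ d) <-> gb_steps y c /\ gb_steps (chain_perm c \o y) d.
Proof.
elim: c y => [|t c IHc] y /=; first by intuition.
by rewrite chain_perm_cons; split=> [[? ? /IHc[]]|[[? ? ?] ?]]; do ?split=> //; apply/IHc.
Qed.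

Lemma gb_le_refl y : gb_le y y.
Proof.
apply/gb_leP; split=> // a; case: (ltngtP a (y a)) => ?.
- by apply: Or31; lia.
- by apply: Or33; lia.
- by apply: Or32; lia.
Qed.

Lemma gb_steps_le y c : gb_steps y c -> gb_le y (chain_perm c \o y).
Proof.
elim: c y => [|t c IHc] y; first by move=> _; exact: gb_le_refl.
by case=> _ le_t c_t; rewrite chain_perm_cons; apply: gb_le_trans le_t (IHc _ c_t).
Qed.

Lemma gb_steps_quot x y c : bijective x -> injective y ->
  gb_le x (y \o x) -> gb_steps (y \o x) c -> gb_steps y c.
Proof.
move=> bx; elim: c y => [|t c IHc] y //= yI le_x [t12 le_t c_t]; split=> //.
  exact: gb_le_quot le_x le_t.
apply: IHc => //; first exact: inj_comp (inv_inj (transp_funK t)) yI.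
exact: gb_le_trans le_x le_t.
Qed.

Lemma gb_steps_shift x y c : injective x -> injective y ->
  gb_le x (chain_perm c \o y \o x) -> gb_steps y c -> gb_steps (y \o x) c.
Proof.
move=> xI; elim: c y => [|t c IHc] y //= yI; rewrite chain_perm_cons.
move=> le_x [t12 le_t c_t]; set ty := transp_fun t \o y in le_t c_t.
have tyI : injective ty by exact: inj_comp (inv_inj (transp_funK t)) yI.
split=> //; last exact: (IHc ty tyI le_x c_t).
have zI : injective (chain_perm c \o ty) by apply: inj_comp tyI; exact: chain_perm_inj.
(* Since [ty] is below the full product, x <= ty x; this is the hypothesis needed to shift the
   single step from [y] to [ty]. *)
have [le1 _] := gb_le_shift xI zI tyI le_x (gb_steps_le c_t).
by have [] := gb_le_shift xI tyI yI le1 le_t.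
Qed.

Lemma gb_word_factor s w s' : gb_word (s ++ w ++ s') -> gb_word w.
Proof.
move=> /gb_steps_cat[s_w /gb_steps_cat[w_w _]].
apply: (@gb_steps_quot (chain_perm s) id) w_w => //; first exact: chain_perm_bij.
exact: gb_le_refl.
Qed.

Lemma gb_word_subst s w w' s' : chain_perm w = chain_perm w' -> gb_word w' ->
  gb_word (s ++ w ++ s') -> gb_word (s ++ w' ++ s').
Proof.
move=> eq_w w'_w /gb_steps_cat[s_w /gb_steps_cat[w_w s'_w]].
apply/gb_steps_cat; split=> //; apply/gb_steps_cat; rewrite -eq_w; split=> //.
apply: (@gb_steps_shift (chain_perm s) id) => //; first exact: chain_perm_inj.
by rewrite -eq_w; apply: gb_steps_le.
Qed.

(** * Deciding [gb_word] *)

(** If [st] represents a permutation, this is the preimage of [v]; a letter that is not listed is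
    fixed. *)
Definition look (st : seq (nat * nat)) (v : nat) : nat :=
  foldr (fun e x => if Nat.eqb e.1 v then e.2 else x) v st.

(** Here [e] is a pair (y x, x), and p, q are the preimages of a, b. After the step p goes to b and
    q to a. A raised point x left of p, or a lowered point x right of q, whose image lies between a
    and b, violates the order clause against p, respectively q. *)
Definition blocks (a b p q : nat) (e : nat * nat) : bool :=
  if Nat.ltb a e.1 then
    if Nat.ltb e.1 b then
      if Nat.ltb e.2 e.1 then Nat.ltb e.2 p else Nat.ltb q e.2
    else false
  else false.

Definition step_ok (st : seq (nat * nat)) (a b p q : nat) : bool :=
  if Nat.ltb a b then if Nat.leb p a then if Nat.leb b q then ~~ has (blocks a b p q) st
  else false else false else false.

Definition step (st : seq (nat * nat)) (t : nat * nat) : option (seq (nat * nat)) :=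
  let: (a, b) := t in
  let p := look st a in
  let q := look st b in
  if step_ok st a b p q then
    Some ((a, q) :: (b, p) ::
          [seq e <- st | if Nat.eqb e.1 a then false else ~~ Nat.eqb e.1 b])
  else None.

Fixpoint run (st : seq (nat * nat)) (w : seq (nat * nat)) : option (seq (nat * nat)) :=
  if w is t :: w' then
    if step st t is Some st' then run st' w' else None
  else Some st.

(* [st] lists pairs (y x, x), with all the non-fixed points x of [y]. *)
Definition represents (st : seq (nat * nat)) (y : nat -> nat) : Prop :=
  (forall e, e \in st -> y e.2 = e.1) /\ (forall x, y x <> x -> (y x, x) \in st).

Lemma nat_eqbE (m n : nat) : Nat.eqb m n = (m == n).
Proof. by apply/idP/eqP => [/PeanoNat.Nat.eqb_eq|/PeanoNat.Nat.eqb_eq]. Qed.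

Lemma nat_lebE (m n : nat) : Nat.leb m n = (m <= n).
Proof. by apply/idP/leP => [/PeanoNat.Nat.leb_le|/PeanoNat.Nat.leb_le]. Qed.

Lemma nat_ltbE (m n : nat) : Nat.ltb m n = (m < n).
Proof. exact: nat_lebE. Qed.

Lemma lookP st y v : represents st y -> bijective y -> y (look st v) = v.
Proof.
move=> [st_y y_st] [y' yK y'K].
have : (look st v, v) \in [seq (e.2, e.1) | e <- st] \/
       look st v = v /\ (forall x, (v, x) \notin st).
  elim: st {st_y y_st} => [|e st IHst] /=; first by right.
  rewrite nat_eqbE; case: eqP => [<-|nev]; first by left; rewrite mem_head.
  case: IHst => [in_st|[lv nst]]; [left | right].
    by rewrite inE in_st orbT.
  split=> // x; rewrite inE negb_or nst andbT; apply/eqP => ee.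
  by apply: nev; rewrite -ee.
case=> [/mapP[e e_st [-> ->]]|[-> nst]]; first exact: st_y.
have [y'v|/eqP ny'v] := eqVneq (y' v) v; first by rewrite -{1}y'v y'K.
have := y_st (y' v); rewrite y'K => /(_ (nesym ny'v)).
by rewrite (negPf (nst _)).
Qed.

(** Only p and q change their images, so a violation of the order clause must involve one of them.
    Fixed points never block, hence inspecting the listed points is enough. *)
Lemma step_okP st y a b : represents st y -> bijective y -> a < b ->
  reflect (gb_le y (transp_fun (a, b) \o y)) (step_ok st a b (look st a) (look st b)).
Proof.
move=> st_y by_; have [st1 st2] := st_y; have yI := bij_inj by_.
have := lookP a st_y by_; have := lookP b st_y by_.
set p := look st a; set q := look st b => yq yp ab.
have zE x : (transp_fun (a, b) \o y) x =
    if x == p then b else if x == q then a else y x.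
  by rewrite /= /transp_fun /= -{1}yp -{2}yq !(inj_eq yI).
have npq : p == q = false by rewrite -(inj_eq yI) yp yq; lia.
have npq' : q == p = false by rewrite eq_sym.
have blocksE (v x : nat) : blocks a b p q (v, x) =
    (a < v < b) && ((x < v) && (x < p) || ~~ (x < v) && (q < x)).
  by rewrite /blocks /= !nat_ltbE; do ![case: ltnP => ? //=].
have nblocksP : b <= q -> reflect (forall x, a < y x < b -> ~ (x < y x /\ x < p) /\
      ~ (y x < x /\ q < x)) (~~ has (blocks a b p q) st).
  move=> bq; apply: (iffP hasPn) => [nb x yx|nb [v x] /st1 /= <-].
    have [|/eqP/st2/nb] := eqVneq (y x) x; first by lia.
    by rewrite blocksE; lia.
  rewrite blocksE; apply/negP => /andP[yx bl]; have [] := nb x yx.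
  move: yx bl; lia.
rewrite /step_ok nat_ltbE ab !nat_lebE; apply: (iffP idP) => [|/gb_leP[zt zm]].
  case: leqP => // pa; case: leqP => // bq /(nblocksP bq) nb.
  apply/gb_leP; split=> [x|x x'].
    rewrite zE; case: eqP => [->|_]; first by rewrite yp; apply: Or31; lia.
    case: eqP => [->|_]; first by rewrite yq; apply: Or33; lia.
    by have /gb_leP[yt _] := gb_le_refl y; apply: yt.
  rewrite !zE; case: (x =P p) => [->|xp]; case: (x' =P p) => [->|x'p] //;
    rewrite ?yp ?npq ?npq'; try lia.
  - case: (x' =P q) => [->|x'q]; first by rewrite yq; lia.
    lia.
  - case: (x =P q) => [->|xq]; first by rewrite yq; lia.
    have := nb x; have [/yI|] := eqVneq (y x) (y p); rewrite ?yp; first lia. lia.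
  - case: (x =P q) => [->|xq]; case: (x' =P q) => [->|x'q]; rewrite ?yq; try lia.
    have := nb x'; have [/yI|] := eqVneq (y x') (y q); rewrite ?yq; lia.
have := zt p; have := zt q; rewrite !zE npq' !eqxx yp yq => ztq ztp.
have -> : p <= a by case: ztp => -[]; lia.
have bq : b <= q by case: ztq => -[]; lia.
rewrite bq; apply/(nblocksP bq) => x yx.
have xp : x == p = false by apply/eqP => xp; move: yx; rewrite xp yp; lia.
have xq : x == q = false by apply/eqP => xq; move: yx; rewrite xq yq; lia.
have := zm x p; have := zm q x; rewrite !zE xp xq npq' !eqxx yp yq.
by case: ztp => -[]; case: ztq => -[]; lia.
Qed.

Lemma step_represents st st' y t : represents st y -> bijective y ->
  step st t = Some st' -> represents st' (transp_fun t \o y).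
Proof.
case: t => a b st_y by_; have [st1 st2] := st_y; have yI := bij_inj by_.
have := lookP a st_y by_; have := lookP b st_y by_.
rewrite /step; set p := look st a; set q := look st b => yq yp.
case: ifP => // ok [<-]; split=> [e|x].
  rewrite !inE mem_filter => /or3P[/eqP->|/eqP->|/andP[]] /=.
  - rewrite yq /transp_fun /= eqxx; case: eqP => // ->.
  - by rewrite yp /transp_fun /= eqxx.
  - rewrite !nat_eqbE; case: ifP => // nea neb /st1 ->.
    by rewrite /transp_fun /= nea (negPf neb).
rewrite /transp_fun /= !inE mem_filter /= !nat_eqbE.
case: (y x =P a) => [yx _|nya].
  have -> : x = p by apply: yI; rewrite yx yp.
  by rewrite !eqxx /= orbT.
case: (y x =P b) => [yx _|nyb /st2 ->].
  have -> : x = q by apply: yI; rewrite yx yq.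
  by rewrite !eqxx.
by move/eqP/negPf: nya => ->; move/eqP/negPf: nyb => ->; rewrite !orbT.
Qed.

Lemma runP w : gb_word w <-> isSome (run [::] w).
Proof.
have : represents [::] id by split.
have : bijective (@id nat) by exact: (Bijective (fun=> erefl) (fun=> erefl)).
rewrite /gb_word; elim: w [::] id => [|t w IHw] st y by_ st_y //.
have stepR := @step_represents st _ y t st_y by_.
have okP := @step_okP st y t.1 t.2 st_y by_.
have ->: run st (t :: w) = if step st t is Some st' then run st' w else None by [].
have : step st t = None <-> ~ (t.1 < t.2 /\ gb_le y (transp_fun t \o y)).
  case: (t) okP => a b /= okP; rewrite /step_ok nat_ltbE; case: ltnP => ab; last first.
    by split=> // _ [].
  have := okP ab; rewrite /step_ok nat_ltbE ab.
  by case=> [le_t|nle]; [split=> // ng; case: ng | split=> // _ [_ /nle]].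
case: (step st t) stepR => [st'|] stepR.
  move=> ok; rewrite -(IHw _ (transp_fun t \o y)); [|apply: bij_comp => //|exact: stepR].
    have [t12 le_t] : t.1 < t.2 /\ gb_le y (transp_fun t \o y).
      by apply: contrapT => /ok.
    by split=> [[]|].
  exact: inv_bij (transp_funK t).
by case=> /(_ erefl) nt _; split=> // -[t12 le_t _]; case: nt.
Qed.

(** * Maximal chains as words of length n with product z *)

Lemma SinfP f : Sinf f <-> bijective f /\ exists N, forall x, N <= x -> f x = x.
Proof.
rewrite /Sinf /=; split=> -[bf ff]; split=> //.
  have /finite_seqP[s sE] := ff; exists (\max_(x <- s) x).+1 => x lt_x.
  apply: contrapT => fx; have : [set` s] x by rewrite -sE.
  by move=> /= xs; have := @leq_bigmax_seq _ s xpredT id x xs isT; lia.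
case: ff => N fN; apply: (sub_finite_set _ (finite_II N)) => x /= fx.
by rewrite ltnNge; apply/negP => /fN.
Qed.

Lemma Sinf_chain_perm c : Sinf (chain_perm c).
Proof.
apply/SinfP; split; first exact: chain_perm_bij.
elim: c => [|t c [N cN]]; first by exists 0.
exists (N + t.1 + t.2 + 1) => x lt_x; rewrite chain_perm_cons /= /transp_fun.
by do 2![case: eqP => [|_]; first lia]; apply: cN; lia.
Qed.

(** The total displacement, the sum of |y x - x|: with truncated subtraction at least one of the two
    summands vanishes. *)
Definition gb_size (N : nat) (y : nat -> nat) : nat :=
  \sum_(x < N) ((y x - x) + (x - y x)).

(** As [y x] lies between [x] and [z x], no displacement decreases, and it increases where [y] and
    [z] differ; such a point is below [N], since [y] fixes what [z] fixes. *)
Lemma gb_size_lt N y z : (forall x, N <= x -> z x = x) -> gb_lt y z ->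
  gb_size N y < gb_size N z.
Proof.
move=> zN [/gb_leP[yt _] nyz].
have [x nyx] : exists x, y x <> z x.
  by apply: contrapT => /forallNP e; apply: nyz; apply: funext => x; apply: contrapT; exact: e.
have xN : x < N.
  rewrite ltnNge; apply/negP => /zN zx; move: nyx; have := yt x.
  by rewrite zx; case=> -[]; lia.
have le_d i : (y i - i) + (i - y i) <= (z i - i) + (i - z i).
  by have := yt i; case=> -[]; lia.
rewrite /gb_size (bigD1 (Ordinal xN)) //= [ltnRHS](bigD1 (Ordinal xN)) //=.
rewrite -addSn; apply: leq_add; last by apply: leq_sum => i _; exact: le_d.
by have := yt x; case=> -[]; lia.
Qed.

(* A strict chain which is not saturated can be refined, and [gb_size z] bounds
   its length; hence a strict chain with [n] steps is saturated. *)
Lemma has_rank_cover z n (y : nat -> nat -> nat) : Sinf z -> has_rank z n ->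
  y 0 = id -> y n = z -> (forall j, j <= n -> Sinf (y j)) ->
  (forall j, j < n -> gb_lt (y j) (y j.+1)) ->
  forall j, j < n -> gb_cover (y j) (y j.+1).
Proof.
move=> /SinfP[_ [N zN]] rank_z.
pose strict m (x : nat -> nat -> nat) :=
  [/\ x 0 = id, x m = z, forall j, j <= m -> Sinf (x j) &
      forall j, j < m -> gb_lt (x j) (x j.+1)].
have le_x m x j k : strict m x -> j <= k <= m -> gb_le (x j) (x k).
  case=> _ _ _ lt_x; elim: k => [|k IHk] jk.
    by have -> : j = 0; [lia | exact: gb_le_refl].
  have [->|njk] := eqVneq j k.+1; first exact: gb_le_refl.
  by apply: gb_le_trans (IHk _) (lt_x k _).1; lia.
have bound m x : strict m x -> m <= gb_size N z.
  move=> sx; have [_ xm _ lt_x] := sx; rewrite -xm.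
  suff H k : k <= m -> k <= gb_size N (x k) by exact: H.
  elim: k => // k IHk lt_k; have /(_ (ltnW lt_k)) := IHk.
  have /(gb_size_lt _) : gb_lt (x k) (x k.+1) by exact: lt_x.
  move=> /(_ N) lt_s le_s; apply: leq_ltn_trans le_s (lt_s _) => i /zN zi.
  have /gb_leP[/(_ i)] : gb_le (x k.+1) z by rewrite -xm; apply: (le_x m) => //; lia.
  by rewrite zi; case=> -[]; lia.
(* Induction on the room left for insertions. A saturated chain has [n] steps by the definition of
   the rank; inserting an element into an unsaturated one gives a strict chain with [m.+1] steps, so
   that [m < n]. *)
have refine m x : strict m x ->
    m <= n /\ (m = n -> forall j, j < n -> gb_cover (x j) (x j.+1)).
  have [d] := ubnP (gb_size N z - m); elim: d m x => // d IHd m x lt_d sx.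
  have [x0 xm Sx lt_x] := sx.
  have [x_cov|/existsNP[j /not_implyP[lt_j ncov]]] :=
      pselect (forall j, j < m -> gb_cover (x j) (x j.+1)).
    have mn : m = n by apply/rank_z; exists x.
    by rewrite -mn.
  have [w Sw [ltw1 ltw2]] : exists2 w, Sinf w & gb_lt (x j) w /\ gb_lt w (x j.+1).
    by apply: contrapT => nw; apply: ncov; split; [exact/Sx/ltnW|exact: Sx|exact: lt_x|].
  pose x' k := if k <= j then x k else if k == j.+1 then w else x k.-1.
  have sx' : strict m.+1 x'.
    split=> [||k le_k|k lt_k]; rewrite /x'.
    - by rewrite x0.
    - by rewrite ifN; [rewrite ifN //; lia|lia].
    - by case: ifP => ?; [|case: ifP => // ?]; apply: Sx; lia.
    have [kj|[->|[->|jk]]] : k < j \/ k = j \/ k = j.+1 \/ j.+1 < k by lia.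
    - by rewrite !ifT; [apply: lt_x; lia|lia|lia].
    - by rewrite leqnn eqxx ltnn.
    - by rewrite ltnn eqxx ifN; [rewrite ifN; [|lia]|lia].
    do 4![rewrite ifN; last lia].
    by have {2}-> : k = k.-1.+1; [lia|apply: lt_x; lia].
  have := bound _ _ sx'; have [] := IHd m.+1 x' _ sx'; last by lia.
  by have := bound _ _ sx'; lia.
by move=> y0 yn Sy lt_y; have [_] := refine n y (And4 y0 yn Sy lt_y); apply.
Qed.

Lemma gb_stepsP y c : gb_steps y c <-> (forall t, t \in c -> t.1 < t.2) /\
  forall j, j < size c -> gb_le (chain_perm (take j c) \o y) (chain_perm (take j.+1 c) \o y).
Proof.
elim: c y => [|t c IHc] y; first by split=> // _; split=> // u; rewrite inE.
have tk j : chain_perm (take j.+1 (t :: c)) = chain_perm (take j c) \o transp_fun t.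
  by rewrite /= chain_perm_cons.
split=> [[t12 le_t /IHc[c12 c_le]]|[c12 c_le]].
  split=> [u|[|j] lt_j]; last by rewrite !tk; exact: c_le.
    by rewrite inE => /predU1P[->|/c12].
  by rewrite tk !take0; exact: le_t.
split; first by apply: c12; rewrite mem_head.
  by have := c_le 0; rewrite tk !take0; apply.
apply/IHc; split=> [u uc|j lt_j]; first by apply: c12; rewrite inE uc orbT.
by have := c_le j.+1; rewrite !tk; apply.
Qed.

Lemma is_chainP z n c : Sinf z -> has_rank z n ->
  is_chain z n c <-> [/\ size c = n, gb_word c & chain_perm c = z].
Proof.
move=> Sz rank_z; split=> [[sz c12 c_cov cz]|[sz /gb_stepsP[c12 c_le] cz]].
  split=> //; apply/gb_stepsP; rewrite sz; split=> // j lt_j.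
  by case: (c_cov j lt_j) => _ _ [].
split=> //; apply: (@has_rank_cover z n (fun j => chain_perm (take j c))) => //.
- by rewrite take0.
- by rewrite take_oversize ?sz.
- by move=> j _; exact: Sinf_chain_perm.
move=> j lt_j; split; first by apply: c_le; rewrite sz.
have tc : nth (0, 0) c j \in c by rewrite mem_nth ?sz.
rewrite (take_nth (0, 0)) ?sz // -cats1 chain_perm_cat chain_perm_cons /=.
set t := nth _ _ _ in tc *; have [x' _ xK] := chain_perm_bij (take j c).
move=> /(congr1 (@^~ (x' t.1))) /=; rewrite xK /transp_fun eqxx => e.
by have := c12 t tc; rewrite (e : t.1 = t.2) ltnn.
Qed.

(** * The finite checks *)

(* Comparisons are written with [Nat.ltb], [Nat.leb] and [Nat.eqb], which the
   kernel evaluates much faster than the boolean relations of MathComp. *)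

Definition transp_eqb (t u : nat * nat) : bool :=
  if Nat.eqb t.1 u.1 then Nat.eqb t.2 u.2 else false.

Fixpoint word_eqb (v w : seq (nat * nat)) : bool :=
  match v, w with
  | [::], [::] => true
  | t :: v', u :: w' => if transp_eqb t u then word_eqb v' w' else false
  | _, _ => false
  end.

Definition desb (t u : nat * nat) : bool := Nat.ltb u.2 t.2.

Fixpoint des_bits (w : seq (nat * nat)) : seq bool :=
  if w is t :: w' then
    if w' is u :: _ then desb t u :: des_bits w' else [::]
  else [::].

Fixpoint increasing (s : seq nat) : bool :=
  if s is x :: s' then
    if s' is y :: _ then if Nat.ltb x y then increasing s' else false else true
  else true.

Definition disjointb (t u : nat * nat) : bool :=
  if Nat.ltb t.2 u.1 then true else if Nat.ltb u.2 t.1 then true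
  else if Nat.ltb t.1 u.1 then Nat.ltb u.2 t.2
  else if Nat.ltb u.1 t.1 then Nat.ltb t.2 u.2 else false.

Definition when (b : bool) (w : seq (nat * nat)) : seq (seq (nat * nat)) :=
  if b then [:: w] else [::].

(** Under call-by-value evaluation [&&] would always compute both arguments. *)
Local Notation "b &&& c" := (if b then c else false) (at level 40, left associativity).

(** The middle transposition tells the direction: the letter common to all three is its larger one
    on the left sides of both rules (A), and its smaller one on the right sides. *)
Definition movesA (t1 t2 t3 : nat * nat) : seq (seq (nat * nat)) :=
  let: ((p, q), (r, s), (x, y)) := (t1, t2, t3) in
  if Nat.eqb p s then
    if Nat.eqb p x then
      when (increasing [:: r; p; q; y]) [:: (r, q); (q, y); (p, q)] ++
      when (increasing [:: r; p; y; q]) [:: (p, y); (y, q); (r, y)]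
    else [::]
  else if Nat.eqb q r then
    if Nat.eqb q y then
      when (increasing [:: p; x; q; s]) [:: (x, q); (p, x); (x, s)] ++
      when (increasing [:: x; p; q; s]) [:: (p, s); (x, p); (p, q)]
    else [::]
  else [::].

(** Both directions of a rule (B) swap two neighbours, provided that the label of the remaining
    entry lies strictly between theirs; this entry is the first one in the first summand and the
    last one in the second. *)
Definition movesB (t1 t2 t3 : nat * nat) : seq (seq (nat * nat)) :=
  when (if Nat.ltb t2.2 t1.2 then Nat.ltb t1.2 t3.2 &&& disjointb t2 t3
        else Nat.ltb t3.2 t1.2 &&& Nat.ltb t1.2 t2.2 &&& disjointb t2 t3)
       [:: t1; t3; t2] ++
  when (if Nat.ltb t2.2 t3.2 then Nat.ltb t3.2 t1.2 &&& disjointb t1 t2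
        else Nat.ltb t1.2 t3.2 &&& Nat.ltb t3.2 t2.2 &&& disjointb t1 t2)
       [:: t2; t1; t3].

(* [nested t u v]: t = (al, be), u = (be, ga) and v = (p, q) for some
   al < be < p < q < ga. *)
Definition nested (t u v : nat * nat) : bool :=
  Nat.eqb t.2 u.1 &&& increasing [:: t.1; t.2; v.1; v.2; u.2].

Definition movesC (t1 t2 t3 : nat * nat) : seq (seq (nat * nat)) :=
  when (nested t2 t3 t1) [:: t2; t3; t1] ++ when (nested t1 t2 t3) [:: t3; t1; t2] ++
  when (nested t2 t1 t3) [:: t3; t1; t2] ++ when (nested t3 t2 t1) [:: t2; t3; t1].

Definition moves (t1 t2 t3 : nat * nat) : seq (seq (nat * nat)) :=
  movesB t1 t2 t3 ++ movesA t1 t2 t3 ++ movesC t1 t2 t3.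

Definition same_bit (b c : bool) : bool := if b then c else if c then false else true.

(* The involution phi_{k+2}: it acts on the entries k, k+1, k+2, counted from 0. *)
Fixpoint phi_at (k : nat) (w : seq (nat * nat)) : seq (nat * nat) :=
  match k, w with
  | 0, t1 :: t2 :: t3 :: w' =>
    if same_bit (desb t1 t2) (desb t2 t3) then w
    else if moves t1 t2 t3 is v :: _ then v ++ w' else w
  | k'.+1, t :: w' => t :: phi_at k' w'
  | _, _ => w
  end.

Fixpoint bfs (K : seq nat) (fuel : nat) (seen todo : seq (seq (nat * nat))) :=
  match todo, fuel with
  | [::], _ => Some seen
  | x :: todo', f.+1 =>
    if has (word_eqb x) seen then bfs K f seen todo'
    else bfs K f (x :: seen) ([seq phi_at k x | k <- K] ++ todo')
  | _, 0 => None
  end.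

Fixpoint bits_eqb (b c : seq bool) : bool :=
  match b, c with
  | [::], [::] => true
  | x :: b', y :: c' => if same_bit x y then bits_eqb b' c' else false
  | _, _ => false
  end.

Fixpoint remove_bits (b : seq bool) (l : seq (seq bool)) :=
  if l is c :: l' then
    if bits_eqb b c then Some l'
    else if remove_bits b l' is Some l'' then Some (c :: l'') else None
  else None.

Fixpoint subtract (T l : seq (seq bool)) :=
  if T is b :: T' then if remove_bits b l is Some l' then subtract T' l' else None
  else Some l.

(* The Schur expansions turn out to be multiplicity free, so that every element of
   [tabs] needs to be tried only once. *)
Fixpoint schur_sum (tabs : seq (seq (seq bool))) (l : seq (seq bool)) : bool :=
  if tabs is T :: tabs' then
    if subtract T l is Some l' then schur_sum tabs' l' else schur_sum tabs' l
  else if l is [::] then true else false.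

(* The rows of a tableau of shape [la] are concatenated in [w], so that its entry j is
   in the row [reshape_index la (index j w)]. *)
Definition syt_des (la : seq nat) : seq (seq bool) :=
  let m := sumn la in
  [seq [seq reshape_index la (index j w) < reshape_index la (index j.+1 w) |
        j <- iota 0 m.-1]
  | w <- [seq w <- permutations (iota 0 m) | semistandard (reshape la w)]].

Definition partitions4 := [:: [:: 4]; [:: 3; 1]; [:: 2; 2]; [:: 2; 1; 1]; [:: 1; 1; 1; 1]].
Definition partitions5 := [:: [:: 5]; [:: 4; 1]; [:: 3; 2]; [:: 3; 1; 1]; [:: 2; 2; 1];
  [:: 2; 1; 1; 1]; [:: 1; 1; 1; 1; 1]].

(** Evaluated here once, so that the checks read a table instead of enumerating tableaux for every
    word. *)
Definition tabs4 := Eval vm_compute in [seq syt_des la | la <- partitions4].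
Definition tabs5 := Eval vm_compute in [seq syt_des la | la <- partitions5].

(* The fuel 70 is enough because the classes have at most 20 elements. *)
Definition class_schur (tabs : seq (seq (seq bool))) (K : seq nat) (w : seq (nat * nat)) :=
  if bfs K 70 [::] [:: w] is Some cl then schur_sum tabs (map des_bits cl) else false.

Definition moved (k : nat) (w : seq (nat * nat)) : bool := ~~ word_eqb (phi_at k w) w.

(** Condition (iv.b) on five entries: the indices 0, 1, 2 stand for i-1, i, i+1. The two classes
    live on the first four and on the last four entries. Comparing multisets of descent patterns
    loses nothing, because the Q_D of one degree are linearly independent. *)
Definition class_eq (w : seq (nat * nat)) : bool :=
  let v := phi_at 1 w in
  if moved 1 w &&& moved 0 w &&& moved 2 w &&& moved 0 v &&& moved 2 v then
    match bfs [:: 0; 1] 70 [::] [:: take 4 w], bfs [:: 0; 1] 70 [::] [:: drop 1 w] with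
    | Some cl, Some cl' =>
       if subtract (map des_bits cl) (map des_bits cl') is Some [::] then true else false
    | _, _ => false
    end
  else true.

(** Lists a cycle of the composite of two involutions; it closes up at its starting point [x0]. *)
Fixpoint orbit_from (p fuel : nat) (x0 x : seq (nat * nat)) :=
  if fuel is f.+1 then
    let y := phi_at p (phi_at 1 x) in
    if word_eqb y x0 then Some [:: x]
    else if orbit_from p f x0 y is Some s then Some (x :: s) else None
  else None.

(** The flag at index k - 1 tells whether phi_(i+1) moves c_k. Thus the indices 2j-2 and 2j-1 belong
    to c_(2j-1) and c_(2j), and the range of [iota] is 1 < j < r. *)
Definition pattern_ok (U : seq bool) : bool :=
  all (fun j => nth true U (2 * j - 2) && nth true U (2 * j - 1) ==>
                all id (take (2 * j) U) || all id (drop (2 * j - 2) U))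
      (iota 2 ((size U)./2 - 2)).

(** [None] is a threshold below every label, 0 included. *)
Definition cut_above (cut : option nat) (l : nat) : bool :=
  if cut is Some b then Nat.ltb b l else true.

Definition cut_pattern (F : seq (nat * bool)) (cut : option nat) : seq bool :=
  [seq f.2 != cut_above cut f.1 | f <- F].

Definition flat_ok (F : seq (nat * bool)) : bool :=
  all (fun cut => pattern_ok (cut_pattern F cut)) (None :: [seq Some f.1 | f <- F]).

(** Depth-first search through all prolongations of a flat chain, kept in reverse order in [acc] and
    lengthened by two elements at a time. Exhausted fuel counts as failure, so success also shows
    that the search was complete. *)
Fixpoint explore (p q : nat) (feat : seq (nat * nat) -> option (nat * bool)) (fuel : nat)
    (acc : seq (seq (nat * nat))) : bool :=
  if flat_ok (pmap feat (rev acc)) then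
    if fuel is f.+1 then
      if acc is c :: _ then
        let x := phi_at p c in
        if orbit_from p 20 x x is Some s then
          all (fun y =>
            if ~~ moved 1 y &&& moved p y then
              let y' := phi_at q y in
              if ~~ word_eqb y' y &&& moved p y' &&& ~~ has (word_eqb y) acc
                 &&& ~~ has (word_eqb y') acc
              then explore p q feat f (y' :: y :: acc) else true
            else true) s
        else false
      else false
    else false
  else false.

(* The fuel 4 is enough because flat chains have at most 8 elements. *)
Definition flat_from (p q : nat) feat (w : seq (nat * nat)) : bool :=
  if moved p w then
    let v := phi_at q w in
    if ~~ word_eqb v w &&& moved p v then explore p q feat 4 [:: v; w] else true
  else true.

(** Being moved by phi_(i+1) means that the last descent bit differs from the comparison of the last
    label with the entry after the window. *)
Definition feat_last (w : seq (nat * nat)) : option (nat * bool) :=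
  if w is [:: _; _; _; t; u] then Some (u.2, desb t u) else None.

(** For the reversed family the neighbour precedes the window, and a label above the threshold means
    that there is no descent; the negated bit compensates for this. *)
Definition feat_first (w : seq (nat * nat)) : option (nat * bool) :=
  if w is [:: t; u; _; _; _] then Some (t.2, ~~ desb t u) else None.

Definition same_perm (v w : seq (nat * nat)) : bool :=
  all (fun x => chain_perm v x == chain_perm w x)
      (flatten [seq [:: t.1; t.2] | t <- v ++ w]).

(** Exactly one interchange applies when the descents differ, so that the choices made in
    [chain_phi] and in [phi_at] are forced; the result is a word with the same product, applying the
    involution again returns [w], and both descents flip. *)
Definition check3 w :=
  if w is [:: t1; t2; t3] then
    if same_bit (desb t1 t2) (desb t2 t3) then true
    else if moves t1 t2 t3 is [:: [:: u1; u2; u3]] then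
      let v := [:: u1; u2; u3] in
      isSome (run [::] v) &&& same_perm v w &&& word_eqb (phi_at 0 v) w
      &&& ~~ same_bit (desb t1 t2) (desb u1 u2) &&& ~~ same_bit (desb t2 t3) (desb u2 u3)
    else false
  else true.

(** The last two parts are (ii.d) and (ii.c): if an involution changes the descent next to its
    window, the neighbouring involution on that side moves the word. *)
Definition check4 w :=
  class_schur tabs4 [:: 0; 1] w &&&
  (if w is [:: t1; t2; t3; t4] then
     (if moved 0 w then
        if phi_at 0 w is [:: _; _; u3; _] then
          if same_bit (desb t3 t4) (desb u3 t4) then true else moved 1 w
        else false
      else true) &&&
     (if moved 1 w then
        if phi_at 1 w is [:: _; u2; _; _] then
          if same_bit (desb t1 t2) (desb t1 u2) then true else moved 0 w
        else false
      else true)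
   else true).

(** Reversal exchanges the places of phi_(i-2) and phi_i in the window, whence [0 2] and [2 0]. *)
Definition check5 w := class_schur tabs5 [:: 0; 1; 2] w &&& class_eq w
  &&& flat_from 0 2 feat_last w &&& flat_from 2 0 feat_first w.

(** * Enumeration of the words up to increasing relabelling *)

Definition shift (k j : nat) : nat := if Nat.leb k j then j.+1 else j.
Definition relabel (g : nat -> nat) (w : seq (nat * nat)) := [seq (g t.1, g t.2) | t <- w].

(* [(false, i)] stands for the letter i < m, and [(true, k)] for a new letter,
   inserted in such a way that it becomes the letter k. *)
Definition insertions (m : nat) : seq (bool * nat) :=
  [seq (false, i) | i <- iota 0 m] ++ [seq (true, k) | k <- iota 0 m.+1].

Definition ins_size (m : nat) (e : bool * nat) : nat := if e.1 then m.+1 else m.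

Definition ins_shift (e : bool * nat) : nat -> nat := if e.1 then shift e.2 else id.

(** The second letter [e'] is placed in the alphabet already enlarged by the first one, so its
    insertion may shift the first letter [e.2] as well. *)
Definition extend (x : nat * seq (nat * nat) * seq (nat * nat)) :=
  let: (m, w, st) := x in
  flatten [seq
    let m' := ins_size m e in
    flatten [seq
      let a := ins_shift e' e.2 in
      if Nat.ltb a e'.2 then
        let g := ins_shift e' \o ins_shift e in
        if step (relabel g st) (a, e'.2) is Some st' then
          [:: (ins_size m' e', rcons (relabel g w) (a, e'.2), st')] else [::]
      else [::]
    | e' <- insertions m']
  | e <- insertions m].

(* The triples consist of a number m, a word in the letters smaller than m, and the
   result of [run] on this word. *)
Fixpoint standard_words (n : nat) :=
  if n is n'.+1 then flatten [seq extend e | e <- standard_words n'] else [:: (0, [::], [::])].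


Lemma check3_standard : all (fun e => check3 e.1.2) (standard_words 3).
Proof. by vm_compute. Qed.

Lemma check4_standard : all (fun e => check4 e.1.2) (standard_words 4).
Proof. by vm_compute. Qed.

Lemma check5_standard : all (fun e => check5 e.1.2) (standard_words 5).
Proof. by vm_compute. Qed.

(** * Relabelling *)

Section Relabel.

Variable g : nat -> nat.
Hypothesis g_lt : forall x y, (g x < g y) = (x < y).

Let ltb_g x y : Nat.ltb (g x) (g y) = Nat.ltb x y.
Proof. by rewrite !nat_ltbE g_lt. Qed.

Let leb_g x y : Nat.leb (g x) (g y) = Nat.leb x y.
Proof. by rewrite !nat_lebE leqNgt g_lt -leqNgt. Qed.

Let eqb_g x y : Nat.eqb (g x) (g y) = Nat.eqb x y.
Proof.
rewrite !nat_eqbE; apply/eqP/eqP => [e|->//].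
by have := g_lt x y; have := g_lt y x; rewrite e ltnn; lia.
Qed.

Local Notation gt := (fun t : nat * nat => (g t.1, g t.2)).
Local Notation rl := (relabel g).

Lemma transp_eqb_relabel t u : transp_eqb (gt t) (gt u) = transp_eqb t u.
Proof. by rewrite /transp_eqb /= !eqb_g. Qed.

Lemma word_eqb_relabel v w : word_eqb (rl v) (rl w) = word_eqb v w.
Proof.
by elim: v w => [|t v IHv] [|u w] //=; rewrite transp_eqb_relabel IHv.
Qed.

Lemma desb_relabel t u : desb (gt t) (gt u) = desb t u.
Proof. by rewrite /desb /= ltb_g. Qed.

Lemma des_bits_relabel w : des_bits (rl w) = des_bits w.
Proof. by elim: w => [|t [|u w] IHw] //=; rewrite desb_relabel; congr cons; exact: IHw. Qed.

Lemma disjointb_relabel t u : disjointb (gt t) (gt u) = disjointb t u.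
Proof. by rewrite /disjointb /= !ltb_g. Qed.

Lemma nested_relabel t u v : nested (gt t) (gt u) (gt v) = nested t u v.
Proof. by rewrite /nested /= !eqb_g !ltb_g. Qed.

Lemma when_relabel b w : when b (rl w) = map rl (when b w).
Proof. by case: b. Qed.

Lemma moves_relabel t1 t2 t3 :
  moves (gt t1) (gt t2) (gt t3) = map rl (moves t1 t2 t3).
Proof.
rewrite /moves !map_cat; congr (_ ++ (_ ++ _)).
- by rewrite /movesB -!when_relabel !disjointb_relabel /= !ltb_g.
- case: t1 t2 t3 => [p q] [r s] [x y]; rewrite /movesA /= !eqb_g !ltb_g.
  by do ![case: ifP => _ //=].
- by rewrite /movesC -!when_relabel !nested_relabel.
Qed.

Lemma phi_at_relabel k w : phi_at k (rl w) = rl (phi_at k w).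
Proof.
elim: k w => [|k IHk] [|t1 w] //=; last by rewrite IHk.
case: w => [|t2 [|t3 w]] //=; rewrite !desb_relabel; case: ifP => // _.
rewrite moves_relabel; case: (moves _ _ _) => [|v l] //=.
by rewrite /relabel map_cat.
Qed.

#[local] Arguments phi_at : simpl never.

Lemma moved_relabel k w : moved k (rl w) = moved k w.
Proof. by rewrite /moved phi_at_relabel word_eqb_relabel. Qed.

Lemma has_word_eqb_relabel x s : has (word_eqb (rl x)) (map rl s) = has (word_eqb x) s.
Proof. by rewrite has_map; apply: eq_has => y /=; rewrite word_eqb_relabel. Qed.

Lemma bfs_relabel K f seen todo :
  bfs K f (map rl seen) (map rl todo) = omap (map rl) (bfs K f seen todo).
Proof.
elim: f seen todo => [|f IHf] seen [|x todo] //=.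
rewrite has_word_eqb_relabel; case: ifP => _; first exact: IHf.
rewrite -IHf map_cat -map_comp; congr (bfs _ _ _ (_ ++ _)).
by apply: eq_map => k /=; rewrite phi_at_relabel.
Qed.

Lemma bfs1_relabel K f w :
  bfs K f [::] [:: rl w] = omap (map rl) (bfs K f [::] [:: w]).
Proof. exact: bfs_relabel K f [::] [:: w]. Qed.

Lemma map_des_bits_relabel l : map des_bits (map rl l) = map des_bits l.
Proof. by rewrite -map_comp; apply: eq_map => w /=; rewrite des_bits_relabel. Qed.

Lemma class_schur_relabel tabs K w : class_schur tabs K (rl w) = class_schur tabs K w.
Proof.
rewrite /class_schur bfs1_relabel.
by set b := bfs _ _ _ _; case: b => [cl|] //=; rewrite map_des_bits_relabel.
Qed.

Lemma class_eq_relabel w : class_eq (rl w) = class_eq w.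
Proof.
rewrite /class_eq phi_at_relabel !moved_relabel; case: ifP => // _.
have takeE : take 4 (rl w) = rl (take 4 w) by rewrite /relabel map_take.
have dropE : drop 1 (rl w) = rl (drop 1 w) by rewrite /relabel map_drop.
rewrite takeE dropE !bfs1_relabel.
set b := bfs _ _ _ [:: take 4 w]; set b' := bfs _ _ _ [:: drop 1 w].
case: b b' => [cl|] [cl'|] //=.
by rewrite !map_des_bits_relabel.
Qed.

Lemma orbit_from_relabel p f x0 x :
  orbit_from p f (rl x0) (rl x) = omap (map rl) (orbit_from p f x0 x).
Proof.
elim: f x => //= f IHf x; rewrite !phi_at_relabel word_eqb_relabel; case: ifP => // _.
by rewrite IHf; case: (orbit_from _ _ _ _).
Qed.

#[local] Arguments orbit_from : simpl never.

Lemma cut_pattern_relabel F cut :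
  cut_pattern [seq (g f.1, f.2) | f <- F] (omap g cut) = cut_pattern F cut.
Proof.
rewrite /cut_pattern -map_comp; apply: eq_map => f /=.
by case: cut => //= b; rewrite ltb_g.
Qed.

Lemma flat_ok_relabel F : flat_ok [seq (g f.1, f.2) | f <- F] = flat_ok F.
Proof.
rewrite /flat_ok (_ : None :: _ = [seq omap g cut | cut <- None :: [seq Some f.1 | f <- F]]).
  by rewrite all_map; apply: eq_all => cut /=; rewrite cut_pattern_relabel.
by rewrite /= -!map_comp.
Qed.

Lemma explore_relabel p q feat f acc :
  (forall w, feat (rl w) = omap (fun F : nat * bool => (g F.1, F.2)) (feat w)) ->
  explore p q feat f (map rl acc) = explore p q feat f acc.
Proof.
move=> featE; elim: f acc => [|f IHf] acc /=; rewrite -map_rev.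
  rewrite (_ : pmap feat _ = [seq (g F.1, F.2) | F <- pmap feat (rev acc)]).
    by rewrite flat_ok_relabel.
  by elim: (rev acc) => //= w s IHs; rewrite featE; case: (feat w) => //= F; rewrite IHs.
rewrite (_ : pmap feat _ = [seq (g F.1, F.2) | F <- pmap feat (rev acc)]); last first.
  by elim: (rev acc) => //= w s IHs; rewrite featE; case: (feat w) => //= F; rewrite IHs.
rewrite flat_ok_relabel; case: ifP => // _; case: acc => //= c acc.
rewrite phi_at_relabel orbit_from_relabel; case: (orbit_from _ _ _ _) => //= s.
rewrite all_map; apply: eq_all => y /=.
rewrite !moved_relabel !phi_at_relabel !word_eqb_relabel !has_word_eqb_relabel.
by have /= -> := IHf [:: phi_at q y, y, c & acc]; rewrite moved_relabel.
Qed.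

Lemma flat_from_relabel p q feat w :
  (forall w, feat (rl w) = omap (fun F : nat * bool => (g F.1, F.2)) (feat w)) ->
  flat_from p q feat (rl w) = flat_from p q feat w.
Proof.
move=> featE; rewrite /flat_from !phi_at_relabel moved_relabel word_eqb_relabel.
have := explore_relabel p q 4 [:: phi_at q w; w] featE.
by rewrite [map _ _]/= => ->; rewrite moved_relabel.
Qed.

Lemma check5_relabel w : check5 (rl w) = check5 w.
Proof.
rewrite /check5 class_schur_relabel class_eq_relabel !flat_from_relabel //.
  by case=> [|t [|u [|? [|? [|? [|? ?]]]]]] //=; rewrite desb_relabel.
by case=> [|? [|? [|? [|t [|u [|? ?]]]]]] //=; rewrite desb_relabel.
Qed.

Lemma chain_perm_relabel w x : chain_perm (rl w) (g x) = g (chain_perm w x).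
Proof.
elim: w x => [|t w IHw] x //=; rewrite !chain_perm_cons /= -IHw; congr chain_perm.
by rewrite /transp_fun /= -!nat_eqbE !eqb_g; do 2!case: ifP => // _.
Qed.

Lemma letters_relabel w :
  flatten [seq [:: t.1; t.2] | t <- rl w] =
  map g (flatten [seq [:: t.1; t.2] | t : nat * nat <- w]).
Proof. by elim: w => //= t w ->. Qed.

Lemma same_perm_relabel v w : same_perm (rl v) (rl w) = same_perm v w.
Proof.
rewrite /same_perm /relabel -map_cat -/(rl _) -/(rl v) -/(rl w) letters_relabel all_map.
by apply: eq_all => x /=; rewrite !chain_perm_relabel -!nat_eqbE eqb_g.
Qed.

Lemma look_relabel st v : look (rl st) (g v) = g (look st v).
Proof.
by elim: st => [|e st IHst] //=; rewrite eqb_g -/(look (rl st) _) IHst; case: ifP.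
Qed.

Lemma step_relabel st t : step (rl st) (gt t) = omap rl (step st t).
Proof.
case: t => a b; rewrite /step /= !look_relabel /step_ok !ltb_g !leb_g.
rewrite has_map (@eq_has _ _ (blocks a b (look st a) (look st b))) => [|e]; last first.
  by rewrite /= /blocks /= !ltb_g.
case: ifP => //= _; congr (Some (_ :: _ :: _)).
rewrite /relabel filter_map; congr map; apply: eq_filter => e /=.
by rewrite !eqb_g.
Qed.

Lemma run_relabel st w : run (rl st) (rl w) = omap rl (run st w).
Proof.
elim: w st => [|t w IHw] st //.
transitivity (if step (rl st) (gt t) is Some st' then run st' (rl w) else None) => //.
by rewrite step_relabel [run st _]/=; case: (step st t) => //= st'.
Qed.

Lemma check4_relabel w : check4 (rl w) = check4 w.
Proof.
rewrite /check4 class_schur_relabel !moved_relabel !phi_at_relabel.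
case: ifP => // _; case: w => [|t1 [|t2 [|t3 [|t4 [|? ?]]]]] //.
move: (phi_at 0 _) (phi_at 1 _) (moved 0 _) (moved 1 _) => P0 P1 M0 M1 /=.
case: P0 => [|? [|? [|? [|? [|? ?]]]]]; case: P1 => [|? [|? [|? [|? [|? ?]]]]] //=;
  by rewrite ?desb_relabel.
Qed.

Lemma check3_relabel w : check3 (rl w) = check3 w.
Proof.
case: w => [|t1 [|t2 [|t3 [|? ?]]]] //.
rewrite -[rl _]/[:: gt t1; gt t2; gt t3] /check3; cbv beta iota.
rewrite !desb_relabel; case: ifP => // _.
rewrite moves_relabel; case: (moves _ _ _) => [|[|u1 [|u2 [|u3 [|? ?]]]] [|? ?]] //.
rewrite -[map rl _]/[:: [:: gt u1; gt u2; gt u3]]; cbv beta iota; rewrite !desb_relabel.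
rewrite -[[:: gt u1; gt u2; gt u3]]/(rl [:: u1; u2; u3]).
rewrite -[[:: gt t1; gt t2; gt t3]]/(rl [:: t1; t2; t3]).
rewrite phi_at_relabel word_eqb_relabel same_perm_relabel.
have -> : run [::] (rl [:: u1; u2; u3]) = omap rl (run [::] [:: u1; u2; u3]).
  exact: run_relabel [::] _.
by case: (run _ _).
Qed.

End Relabel.

(** * Standard words *)

Lemma strict_mono (g : nat -> nat) : (forall x, g x < g x.+1) ->
  forall x y, (g x < g y) = (x < y).
Proof.
move=> /(homo_ltn ltn_trans) g_lt x y; case: (ltngtP x y) => [/g_lt->//|/g_lt|->].
  by move=> gyx; apply/negbTE; rewrite -leqNgt ltnW.
by rewrite ltnn.
Qed.

Definition below (m : nat) (w : seq (nat * nat)) : bool :=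
  all (fun t => (t.1 < m) && (t.2 < m)) w.

Lemma relabel_below m g h w : below m w -> (forall x, x < m -> g x = h x) ->
  relabel g w = relabel h w.
Proof.
move=> /allP wm gh; apply/eq_in_map => t /wm/andP[t1 t2].
by rewrite !gh.
Qed.

Lemma below_relabel m m' g w : below m w -> (forall x, x < m -> g x < m') ->
  below m' (relabel g w).
Proof.
move=> /allP wm gm; rewrite /below all_map; apply/allP => t /wm/andP[t1 t2] /=.
by rewrite !gm.
Qed.

Lemma step_below m st st' a b : below m st -> a < m -> b < m ->
  step st (a, b) = Some st' -> below m st'.
Proof.
move=> stm am bm.
have lm v : v < m -> look st v < m.
  move=> vm; elim: st stm => //= e st IHst /andP[/andP[_ e2] stm].
  by case: ifP => // _; exact: IHst.
rewrite /step; case: ifP => // _ [<-]; rewrite /= am bm !lm //=.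
by apply/allP => e; rewrite mem_filter => /andP[_ /(allP stm)].
Qed.

Lemma ins_shift_lt m e x : x < m -> ins_shift e x < ins_size m e.
Proof.
by case: e => -[] k //= xm; rewrite /ins_shift /ins_size /shift /= nat_lebE; case: ifP; lia.
Qed.

(** The map [g] places the [m] letters of a standard word among the numbers; [e] names the letter or
    the gap at which [a] is found, and [h] is the placement of the enlarged alphabet. *)
Lemma insertion_exists m (g : nat -> nat) a : (forall x, g x < g x.+1) ->
  exists e h, [/\ e \in insertions m, (forall x, h x < h x.+1), h e.2 = a,
    e.2 < ins_size m e & forall x, x < m -> h (ins_shift e x) = g x].
Proof.
move=> g_lt; have gM := strict_mono g_lt.
have [[i [im <-]]|na] := pselect (exists i, i < m /\ g i = a).
  exists (false, i), g; split=> //.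
  by rewrite mem_cat map_f // mem_iota.
have [k km [ltk gtk]] : exists2 k, k <= m &
    (forall i, i < k -> g i < a) /\ (forall i, k <= i < m -> a < g i).
  elim: m na => [|m IHm] na; first by exists 0 => //; split=> // i; lia.
  have [|k km [ltk gtk]] := IHm.
    by move=> [i [im gi]]; apply: na; exists i; split=> //; lia.
  case: (ltngtP (g m) a) => [gma|agm|gma]; last by case: na; exists m.
    exists m.+1 => //; split=> i im; last by lia.
    by apply: leq_ltn_trans gma; rewrite leqNgt gM -leqNgt.
  exists k; first by lia.
  split=> // i im; have [->//|nim] := eqVneq i m.
  by apply: gtk; lia.
(* Beyond [m] the values are irrelevant except for monotonicity; the summand [a + 1] keeps them
   above [a] when [a] is the largest letter. *)
pose h i := if i < k then g i else if i == k then a else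
            if i <= m then g i.-1 else g i.-1 + a + 1.
exists (true, k), h; split.
- by rewrite mem_cat orbC map_f // mem_iota; lia.
- move=> i; rewrite /h; have g1 := g_lt i; have g2 := g_lt i.-1.
  have lti := ltk i; have gti := gtk i.
  have [ik|[ik|[ik|[ik|ik]]]] :
      i.+1 < k \/ i.+1 = k \/ i = k \/ (k < i < m \/ k < i /\ m <= i).
    by lia.
  - by rewrite !ifT; lia.
  - by rewrite -ik ltnn eqxx ltnSn; lia.
  - rewrite -ik ltnn eqxx ifN; last lia.
    rewrite ifN; last lia.
    by case: ifP => ? /=; lia.
  - rewrite prednK in g2; last lia.
    rewrite ifN; last lia.
    rewrite ifN; last lia.
    rewrite ifT; last lia.
    rewrite ifN; last lia.
    by rewrite ifN; [rewrite ifT /=; lia|lia].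
  rewrite prednK in g2; last lia.
  rewrite ifN; last lia.
  rewrite ifN; last lia.
  case: (i <= m); (rewrite ifN; last lia); (rewrite ifN; last lia).
    by rewrite ifN /=; lia.
  by rewrite ifN /=; lia.
- by rewrite /h /= ltnn eqxx.
- by rewrite /ins_size /=; lia.
move=> x xm; rewrite /ins_shift /shift /= nat_lebE /h.
have [kx|xk] := leqP k x.
  by rewrite ltnNge leqW //= gtn_eqF //= xm.
by rewrite xk.
Qed.

Lemma run_rcons st w t :
  run st (rcons w t) = if run st w is Some st' then step st' t else None.
Proof.
elim: w st => [|u w IHw] st /=; first by case: (step st t).
by case: (step st u) => // st'; rewrite IHw.
Qed.

(** Words are built from the left, as in [extend], which requires the state in the induction: [step]
    commutes with relabelling, so a transposition accepted for a word is accepted for its standard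
    form. *)
Lemma standard_words_complete w st : run [::] w = Some st ->
  exists g m w0 st0, [/\ forall x, g x < g x.+1, (m, w0, st0) \in standard_words (size w),
    w = relabel g w0, st = relabel g st0 & below m w0 && below m st0].
Proof.
elim/last_ind: w st => [|w t IHw] st; first by case=> <-; exists id, 0, [::], [::].
rewrite run_rcons size_rcons; case run_w: (run _ _) => [st'|//]; case: t => a b step_t.
have [g [m [w0 [st0 [g_lt in_m wE st'E /andP[w0m st0m]]]]]] := IHw _ run_w.
have [e [h [e_m h_lt he e2 hg]]] := insertion_exists m a g_lt.
have [e' [h' [e'_m h'_lt he' e2' hg']]] := insertion_exists (ins_size m e) b h_lt.
set s := ins_shift e' \o ins_shift e.
have sE x : x < m -> h' (s x) = g x.
  by move=> xm; rewrite /s /= hg' ?hg // ins_shift_lt.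
have relE v : below m v -> relabel g v = relabel h' (relabel s v).
  move=> vm; rewrite (_ : relabel h' _ = relabel (h' \o s) v).
    by apply: (@relabel_below m) => // x xm /=; rewrite -sE.
  by rewrite /relabel -map_comp.
have h'M := strict_mono h'_lt.
have aE : h' (ins_shift e' e.2) = a by rewrite hg'.
have sm x : x < m -> s x < ins_size (ins_size m e) e'.
  by move=> xm; do 2!apply: ins_shift_lt.
move: step_t; rewrite st'E (relE _ st0m) -[in X in X -> _]aE -[in X in X -> _]he'.
rewrite (step_relabel h'M _ (ins_shift e' e.2, e'.2)).
case step_t: (step _ _) => [st1|//] [<-].
exists h', (ins_size (ins_size m e) e'), (rcons (relabel s w0) (ins_shift e' e.2, e'.2)), st1.
split=> //.
- apply/flatten_mapP; exists (m, w0, st0)=> //.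
  apply/flatten_mapP; exists e => //.
  apply/flatten_mapP; exists e' => //; cbv zeta; rewrite (_ : Nat.ltb _ _ = true).
    rewrite -/s.
    by rewrite step_t mem_head.
  by move: step_t; rewrite /step /step_ok; case: Nat.ltb.
- by rewrite wE (relE _ w0m) /relabel map_rcons /= aE he'.
apply/andP; split.
  rewrite /below all_rcons /= e2' ins_shift_lt //=.
  exact: below_relabel w0m sm.
apply: step_below step_t => //; last exact: ins_shift_lt.
exact: below_relabel st0m sm.
Qed.

Lemma check_gb_word (check : seq (nat * nat) -> bool) n w :
  (forall g, (forall x y, (g x < g y) = (x < y)) ->
     forall w, check (relabel g w) = check w) ->
  all (fun x => check x.1.2) (standard_words n) ->
  gb_word w -> size w = n -> check w.
Proof.
move=> checkE /allP check_n /runP; case run_w: (run _ _) => [st|//] _ sw.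
have [g [m [w0 [st0 [/strict_mono gM in_m -> _ _]]]]] := standard_words_complete run_w.
by rewrite checkE //; rewrite sw in in_m; exact: check_n in_m.
Qed.

Lemma gb_word_check3 w : gb_word w -> size w = 3 -> check3 w.
Proof. by apply: check_gb_word check3_standard => g gM v; exact: check3_relabel. Qed.

Lemma gb_word_check4 w : gb_word w -> size w = 4 -> check4 w.
Proof. by apply: check_gb_word check4_standard => g gM v; exact: check4_relabel. Qed.

Lemma gb_word_check5 w : gb_word w -> size w = 5 -> check5 w.
Proof. by apply: check_gb_word check5_standard => g gM v; exact: check5_relabel. Qed.

(** * The involutions on chains *)

Lemma same_bitE b c : same_bit b c = (b == c).
Proof. by case: b; case: c. Qed.

Lemma transp_eqbE (t u : nat * nat) : transp_eqb t u = (t == u).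
Proof. by case: t u => [a b] [c d]; rewrite /transp_eqb /= !nat_eqbE xpair_eqE. Qed.

Lemma word_eqbE (v w : seq (nat * nat)) : word_eqb v w = (v == w).
Proof.
by elim: v w => [|t v IHv] [|u w] //=; rewrite transp_eqbE IHv eqseq_cons.
Qed.

Lemma movedP k w : reflect (phi_at k w <> w) (moved k w).
Proof. by rewrite /moved word_eqbE; apply: (iffP idP) => [/eqP|/eqP]. Qed.

Lemma increasing_path (x : nat) s : increasing (x :: s) = path ltn x s.
Proof.
elim: s x => [|y s IHs] x //.
rewrite -[LHS]/(Nat.ltb x y && increasing (y :: s)) nat_ltbE IHs //.
Qed.

Lemma disjointbE t u : disjointb t u = disjoint_transp t u.
Proof.
rewrite /disjointb /disjoint_transp !nat_ltbE.
by do ![case: ltngtP => //= ?]; lia.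
Qed.

Lemma mem_when b w v : (v \in when b w) = b && (v == w).
Proof. by case: b; rewrite //= inE. Qed.

Lemma moves_interchange t1 t2 t3 v :
  t1.1 < t1.2 -> t2.1 < t2.2 -> t3.1 < t3.2 ->
  v \in moves t1 t2 t3 -> Defs.interchange [:: t1; t2; t3] v.
Proof.
case: t1 t2 t3 => [p q] [r s] [x y] /= pq rs xy.
rewrite /moves mem_cat (mem_cat _ (movesA _ _ _)) => /or3P[].
- rewrite /movesB mem_cat !mem_when /= !nat_ltbE !disjointbE.
  case/orP=> /andP[cond /eqP->].
    move: cond; case: ifP => [sq /andP[qy d]|_ /andP[/andP[yq qs] d]].
      by apply: interchange_B1 => //; rewrite sq.
    by apply/interchange_sym/interchange_B1; rewrite ?yq //;
      move: d; rewrite /disjoint_transp /=; lia.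
  move: cond; case: ifP => [sy /andP[yq d]|_ /andP[/andP[qy ys] d]].
    by apply: interchange_B2; rewrite ?sy //;
      move: d; rewrite /disjoint_transp /=; lia.
  by apply/interchange_sym/interchange_B2; rewrite ?qy //;
    move: d; rewrite /disjoint_transp /=; lia.
- rewrite /movesA !nat_eqbE; case: eqP => [<-|_].
    case: eqP => [<-|//]; rewrite mem_cat !mem_when !increasing_path /= !andbT.
    case/orP=> /andP[/and3P[? ? ?] /eqP->]; first by apply: interchange_A1; lia.
    by apply: interchange_A2; lia.
  case: eqP => [<-|//]; case: eqP => [<-|//].
  rewrite mem_cat !mem_when !increasing_path /= !andbT.
  case/orP=> /andP[/and3P[? ? ?] /eqP->]; apply: interchange_sym.
    by apply: interchange_A1; lia.
  by apply: interchange_A2; lia.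
rewrite /movesC !mem_cat !mem_when /nested !nat_eqbE !increasing_path /= !andbT.
case/or4P=> /andP[/andP[/eqP<- /and4P[? ? ? ?]] /eqP->].
- by apply: interchange_C1; lia.
- by apply/interchange_sym/interchange_C1; lia.
- by apply: interchange_C2; lia.
- by apply/interchange_sym/interchange_C2; lia.
Qed.

Lemma mem_moves t1 t2 t3 v : (v \in moves t1 t2 t3) =
  [|| v \in movesB t1 t2 t3, v \in movesA t1 t2 t3 | v \in movesC t1 t2 t3].
Proof. by rewrite /moves mem_cat (mem_cat _ (movesA _ _ _)). Qed.

Lemma disjoint_transpC t u : disjoint_transp t u = disjoint_transp u t.
Proof. by rewrite /disjoint_transp; lia. Qed.

Lemma interchange_moves u v : Defs.interchange u v ->
  exists t1 t2 t3, u = [:: t1; t2; t3] /\ v \in moves t1 t2 t3.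
Proof.
(* Proving both directions at once makes the induction trivial for [interchange_sym]. *)
move=> uv; suff [] : (exists t1 t2 t3, u = [:: t1; t2; t3] /\ v \in moves t1 t2 t3) /\
  (exists t1 t2 t3, v = [:: t1; t2; t3] /\ u \in moves t1 t2 t3) by [].
elim: uv => {u v} [al be ga de ab gd|al be ga de ab gd|
    a al b be c ga _ _ _ /andP[ab bg] d|a al b be c ga _ _ _ /andP[ab bg] d|
    al be p q ga h1 h2|al be p q ga h1 h2|u v _ [vu uv] //].
- split; do 3!eexists; (split; first reflexivity);
    rewrite mem_moves; apply/orP; right; apply/orP; left; rewrite /movesA !nat_eqbE.
    by rewrite !eqxx mem_cat !mem_when !increasing_path eqxx andbT /=; lia.
  case: eqP => [?|_]; first lia.
  by rewrite !eqxx mem_cat !mem_when !increasing_path eqxx andbT /=; lia.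
- split; do 3!eexists; (split; first reflexivity);
    rewrite mem_moves; apply/orP; right; apply/orP; left; rewrite /movesA !nat_eqbE.
    by rewrite !eqxx mem_cat !mem_when !increasing_path eqxx andbT /=; lia.
  case: eqP => [?|_]; first lia.
  by rewrite !eqxx mem_cat !mem_when !increasing_path eqxx andbT /=; lia.
- split; do 3!eexists; (split; first reflexivity);
    rewrite mem_moves; apply/orP; left;
    rewrite /movesB mem_cat !mem_when eqxx !nat_ltbE !disjointbE /=.
    by rewrite ab bg d.
  by rewrite ltnNge (ltnW bg) /= ab bg disjoint_transpC d.
- split; do 3!eexists; (split; first reflexivity);
    rewrite mem_moves; apply/orP; left;
    rewrite /movesB mem_cat !mem_when eqxx !nat_ltbE !disjointbE /=; apply/orP; right.
    by rewrite ab bg disjoint_transpC d.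
  by rewrite [ga < be]ltnNge (ltnW bg) /= ab bg d.
- split; do 3!eexists; (split; first reflexivity);
    rewrite mem_moves; apply/orP; right; apply/orP; right;
    rewrite /movesC !mem_cat !mem_when /nested !nat_eqbE !increasing_path eqxx andbT /=.
    by rewrite eqxx; lia.
  by rewrite !eqxx; lia.
split; do 3!eexists; (split; first reflexivity);
  rewrite mem_moves; apply/orP; right; apply/orP; right;
  rewrite /movesC !mem_cat !mem_when /nested !nat_eqbE !increasing_path eqxx andbT /=.
  by rewrite !eqxx; lia.
by rewrite !eqxx; lia.
Qed.

Lemma perm_outside w x : x \notin flatten [seq [:: t.1; t.2] | t : nat * nat <- w] ->
  chain_perm w x = x.
Proof.
elim: w => // t w IHw; rewrite /= !inE !negb_or => /and3P[x1 x2 /IHw xw].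
by rewrite chain_perm_cons /= /transp_fun (negPf x1) (negPf x2).
Qed.

Lemma same_permP v w : same_perm v w -> chain_perm v = chain_perm w.
Proof.
move=> /allP same; apply: funext => x.
have [/same/eqP//|] := boolP (x \in flatten [seq [:: t.1; t.2] | t : nat * nat <- v ++ w]).
rewrite map_cat flatten_cat mem_cat negb_or => /andP[xv xw].
by rewrite !perm_outside.
Qed.

Lemma gb_word3 t1 t2 t3 : gb_word [:: t1; t2; t3] -> desb t1 t2 != desb t2 t3 ->
  exists u1 u2 u3, [/\ moves t1 t2 t3 = [:: [:: u1; u2; u3]],
    gb_word [:: u1; u2; u3] /\ chain_perm [:: u1; u2; u3] = chain_perm [:: t1; t2; t3],
    phi_at 0 [:: u1; u2; u3] = [:: t1; t2; t3],
    desb u1 u2 = ~~ desb t1 t2 & desb u2 u3 = ~~ desb t2 t3].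
Proof.
move=> w_gb ndes; have := gb_word_check3 w_gb erefl.
rewrite /check3 same_bitE (negPf ndes).
case: (moves _ _ _) => [|[|u1 [|u2 [|u3 [|? ?]]]] [|? ?]] //.
rewrite !same_bitE word_eqbE; set v := [:: u1; u2; u3].
case: ifP => // /andP[/andP[/andP[v_run v_perm] /eqP v_phi] d12] d23.
exists u1, u2, u3; split=> //; first split; first exact/runP.
- by rewrite (same_permP v_perm).
- by move: d12; case: desb; case: desb.
by move: d23; case: desb; case: desb.
Qed.

Lemma phi_at_cat s w s' k : k + 3 <= size w ->
  phi_at (size s + k) (s ++ w ++ s') = s ++ phi_at k w ++ s'.
Proof.
move=> kw; elim: s => [|t s IHs] /=; last by rewrite IHs.
rewrite add0n; elim: k w kw => [|k IHk] [|t1 w] //= kw; last by rewrite IHk //; lia.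
case: w kw => [|t2 [|t3 w]] //= _; case: ifP => // _.
by case: (moves _ _ _) => // v l; rewrite -catA.
Qed.

Lemma phi_at_short k w : size w < k + 3 -> phi_at k w = w.
Proof.
elim: k w => [|k IHk] [|t1 w] //=; first by case: w => [|? [|? ?]].
by move=> lt_w; rewrite IHk //; lia.
Qed.

Lemma split3 k (w : seq (nat * nat)) : k + 3 <= size w -> exists s t1 t2 t3 s',
  size s = k /\ w = s ++ [:: t1; t2; t3] ++ s'.
Proof.
move=> kw; have := cat_take_drop k w; have : size (take k w) = k.
  by rewrite size_take_min; lia.
have : 3 <= size (drop k w) by rewrite size_drop; lia.
case: (drop k w) => [|t1 [|t2 [|t3 s']]] // _ sk <-.
by exists (take k w), t1, t2, t3, s'.
Qed.

Lemma phi_at_window s t1 t2 t3 s' :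
  phi_at (size s) (s ++ [:: t1; t2; t3] ++ s') = s ++ phi_at 0 [:: t1; t2; t3] ++ s'.
Proof. by rewrite -[size s]addn0 phi_at_cat. Qed.

Lemma phi_at0_id t1 t2 t3 : desb t1 t2 = desb t2 t3 ->
  phi_at 0 [:: t1; t2; t3] = [:: t1; t2; t3].
Proof. by move=> e; rewrite /phi_at same_bitE e eqxx. Qed.

Lemma phi_at0_gb t1 t2 t3 : gb_word [:: t1; t2; t3] ->
  let v := phi_at 0 [:: t1; t2; t3] in
  [/\ gb_word v, chain_perm v = chain_perm [:: t1; t2; t3], size v = 3 &
      phi_at 0 v = [:: t1; t2; t3]].
Proof.
move=> w_gb v; have [e|ne] := eqVneq (desb t1 t2) (desb t2 t3).
  by rewrite /v phi_at0_id // phi_at0_id.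
have [u1 [u2 [u3 [movesE [u_gb u_perm] u_phi _ _]]]] := gb_word3 w_gb ne.
have -> : v = [:: u1; u2; u3] by rewrite /v /phi_at same_bitE (negPf ne) movesE.
by [].
Qed.

Lemma phi_at_gb k w : gb_word w ->
  [/\ gb_word (phi_at k w), chain_perm (phi_at k w) = chain_perm w,
      size (phi_at k w) = size w & phi_at k (phi_at k w) = w].
Proof.
move=> w_gb; have [kw|wk] := leqP (k + 3) (size w); last first.
  by rewrite !phi_at_short.
have [s [t1 [t2 [t3 [s' [sk wE]]]]]] := split3 kw.
rewrite -sk wE phi_at_window; rewrite wE in w_gb.
have [v_gb v_perm v_size v_phi] := phi_at0_gb (gb_word_factor w_gb).
set v := phi_at 0 _ in v_gb v_perm v_size v_phi *.
split; first exact: gb_word_subst w_gb.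
- by rewrite !chain_perm_cat v_perm.
- by rewrite !size_cat v_size.
case: v v_size v_phi {v_gb v_perm} => [|u1 [|u2 [|u3 [|? ?]]]] // _ v_phi.
by rewrite phi_at_window v_phi.
Qed.

Lemma nth_des_bits w j : nth false (des_bits w) j =
  (j.+1 < size w) && desb (nth (0, 0) w j) (nth (0, 0) w j.+1).
Proof.
elim: w j => [|t [|u w] IHw] j; first by rewrite [des_bits _]/= nth_nil.
  by rewrite [des_bits _]/= nth_nil.
by case: j => // j; rewrite -[LHS]/(nth false (des_bits (u :: w)) j) IHw.
Qed.

Lemma chain_DesE c j : chain_Des c j <-> 0 < j /\ nth false (des_bits c) j.-1.
Proof.
rewrite nth_des_bits /chain_Des /label /desb nat_ltbE /=.
by case: j => [|j] /=; split; lia.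
Qed.

Lemma mem_chain_Des c j : (j.+1 \in chain_Des c) = nth false (des_bits c) j.
Proof. by apply/idP/idP => [|d]; rewrite in_setE; [case/chain_DesE | apply/chain_DesE]. Qed.

Lemma nth_des_bits_cat s w s' j : j.+1 < size w ->
  nth false (des_bits (s ++ w ++ s')) (size s + j) = nth false (des_bits w) j.
Proof.
move=> jw; have nthE k : k < size w ->
    nth (0, 0) (s ++ w ++ s') (size s + k) = nth (0, 0) w k.
  by move=> kw; rewrite nth_cat ltnNge leq_addr addKn nth_cat kw.
rewrite !nth_des_bits jw -addnS !nthE ?(ltnW jw) // !size_cat.
by rewrite (_ : size s + j.+1 < _); lia.
Qed.

(** The value of [xget] is determined because candidates are unique: the length of the prefix fixes
    the triple to be replaced, and the new triple belongs to [moves], which has one element. *)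
Lemma chain_phiE i c : gb_word c -> 2 <= i <= size c - 1 ->
  chain_phi i c = phi_at (i - 2) c.
Proof.
case: i => [|[|i]] // c_gb; rewrite (_ : i.+2 - 2 = i) => [/andP[_ ic]|]; last lia.
have [s [t1 [t2 [t3 [s' [si cE]]]]]] : exists s t1 t2 t3 s',
  size s = i /\ c = s ++ [:: t1; t2; t3] ++ s' by apply: split3; lia.
rewrite cE in c_gb *; rewrite /chain_phi subn1 /= !mem_chain_Des.
have -> : nth false (des_bits (s ++ [:: t1; t2; t3] ++ s')) i = desb t1 t2.
  by rewrite -si -[size s]addn0 nth_des_bits_cat.
have -> : nth false (des_bits (s ++ [:: t1; t2; t3] ++ s')) i.+1 = desb t2 t3.
  by rewrite -si -addn1 nth_des_bits_cat.
rewrite -si phi_at_window; case: ifPn => [/eqP e|ne]; first by rewrite phi_at0_id.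
have [u1 [u2 [u3 [movesE [u_gb u_perm] u_phi _ _]]]] := gb_word3 (gb_word_factor c_gb) ne.
have phiE : phi_at 0 [:: t1; t2; t3] = [:: u1; u2; u3].
  by rewrite /phi_at same_bitE (negPf ne) movesE.
rewrite phiE; apply: xget_subset1 => /=.
  exists s, [:: t1; t2; t3], [:: u1; u2; u3], s'; split=> //; first by rewrite si subn2.
  have /gb_stepsP[t12 _] := gb_word_factor c_gb.
  by apply: moves_interchange; rewrite ?t12 ?movesE ?mem_head // !inE eqxx ?orbT.
suff uniq d : interchange_at (size s).+2 (s ++ [:: t1; t2; t3] ++ s') d ->
    d = s ++ [:: u1; u2; u3] ++ s'.
  by move=> d d' /uniq-> /uniq->.
case=> s1 [u [v [s1' [sz cE' -> uv]]]].
have [r1 [r2 [r3 [uE vE]]]] := interchange_moves uv.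
move: cE'; rewrite uE => /eqP; rewrite eqseq_cat ?sz //; last by rewrite subn2.
case/andP=> /eqP<- /eqP[e1 e2 e3 <-].
by move: vE; rewrite -e1 -e2 -e3 movesE inE => /eqP->.
Qed.

Lemma bits_eqbE b c : bits_eqb b c = (b == c).
Proof.
by elim: b c => [|x b IHb] [|y c] //=; rewrite same_bitE IHb eqseq_cons.
Qed.

Lemma remove_bitsP b l l' : remove_bits b l = Some l' -> perm_eq l (b :: l').
Proof.
elim: l l' => //= c l IHl l'; rewrite bits_eqbE; case: eqP => [<- [<-]|_] //.
case: (remove_bits b l) IHl => // l1 /(_ _ erefl) ll1 [<-].
apply: (@perm_trans _ [:: c, b & l1]); first by rewrite perm_cons.
exact: permEl (perm_catCA [:: c] [:: b] l1).
Qed.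

Lemma subtractP T l l' : subtract T l = Some l' -> perm_eq l (T ++ l').
Proof.
elim: T l => [|b T IHT] l /=; first by case=> ->.
case rem: (remove_bits b l) => [l1|] // /IHT ll1.
by apply: perm_trans (remove_bitsP rem) _; rewrite perm_cons.
Qed.

Lemma schur_sumP tabs l : schur_sum tabs l -> exists m, perm_eq l (flatten (mask m tabs)).
Proof.
elim: tabs l => [|T tabs IHt] l /=; first by case: l => // _; exists [::].
case sub: (subtract T l) => [l'|] /IHt[m lm]; last by exists (false :: m).
exists (true :: m); apply: perm_trans (subtractP sub) _.
by rewrite perm_cat2l.
Qed.

(** * Formal series of order invariant sets of words *)

Definition order_invariant (P : pred (seq nat)) : Prop :=
  forall g : nat -> nat, (forall x y, (g x < g y) = (x < y)) ->
  forall w, P (map g w) = P w.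

Lemma mono_leq (g : nat -> nat) : (forall x y, (g x < g y) = (x < y)) ->
  forall x y, (g x <= g y) = (x <= y).
Proof. by move=> g_lt x y; rewrite leqNgt g_lt -leqNgt. Qed.

Lemma schur_invariant la : sorted geq la ->
  order_invariant (fun w => (size w == sumn la) && semistandard (reshape la w)).
Proof.
move=> la_geq g g_lt w; rewrite size_map; case: eqP => //= sw.
have shapeE : shape (reshape la w) = la by rewrite reshapeKl ?sw.
rewrite -map_reshape; set T := reshape la w in shapeE *.
have nthE r : nth [::] (map (map g) T) r = map g (nth [::] T r).
  have [rT|Tr] := ltnP r (size T); first exact: nth_map.
  by rewrite !nth_default ?size_map.
rewrite /semistandard size_map all_map; congr (_ && _).
  apply: eq_all => s /=; rewrite sorted_map.
  by case: s => //= x s; apply: eq_path => y z /=; rewrite mono_leq.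
apply: eq_in_all => r; rewrite mem_iota /= => rT; rewrite !nthE size_map.
apply: eq_in_all => k; rewrite mem_iota /= add0n => kT.
(* The rows do not get longer downwards, so no default value 0, which [g] might not preserve, is
   read in the row above. *)
have sz_le : size (nth [::] T r.+1) <= size (nth [::] T r).
  rewrite -!nth_shape shapeE; move: rT; rewrite -(size_map size T) -/(shape T) shapeE => rT.
  by move/(sortedP 0): la_geq; apply; lia.
by rewrite !(nth_map 0) //; last exact: leq_trans kT sz_le.
Qed.

Definition Qpred (m : nat) (b : seq bool) (w : seq nat) : bool :=
  [&& size w == m, sorted leq w &
      all (fun j => nth false b j.-1 ==> (nth 0 w j.-1 < nth 0 w j)) (iota 1 m.-1)].

Definition bit_set (b : seq bool) : set nat := [set j | 0 < j /\ nth false b j.-1].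

Lemma Q_bit_set m b : Q m (bit_set b) = word_series (Qpred m b).
Proof.
congr word_series; apply: funext => w; rewrite /Qpred; congr [&& _, _ & _].
apply: eq_in_all => j; rewrite mem_iota => /andP[j0 _]; congr (_ ==> _).
by apply/idP/idP => [|bj]; rewrite in_setE; [case|split].
Qed.

Lemma Qpred_invariant m b : order_invariant (Qpred m b).
Proof.
move=> g g_lt w; rewrite /Qpred size_map; case: eqP => //= sw; congr (_ && _).
  by case: w {sw} => //= x s; rewrite path_map; apply: eq_path => y z /=; rewrite mono_leq.
apply: eq_in_all => j; rewrite mem_iota => jm; congr (_ ==> _).
by rewrite !(nth_map 0) ?g_lt //; lia.
Qed.

Fixpoint content_word (i : nat) (cs : seq nat) : seq nat :=
  if cs is c :: cs' then nseq c i ++ content_word i.+1 cs' else [::].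

Definition content (s : seq nat) : seq nat :=
  [seq count_mem x s | x <- sort leq (undup s)].

Lemma perm_count_permutations (g : nat -> nat) (w : seq nat) : injective g ->
  perm_eq (permutations (map g w)) (map (map g) (permutations w)).
Proof.
move=> gI; apply: uniq_perm; first exact: permutations_uniq.
  by rewrite map_inj_uniq ?permutations_uniq //; exact: inj_map.
move=> y; rewrite mem_permutations; apply/idP/mapP => [|[y' y'w ->]]; last first.
  by rewrite perm_map // -mem_permutations.
case/(perm_iotaP 0) => Is IsP ->; rewrite size_map in IsP.
exists [seq nth 0 w i | i <- Is].
  by rewrite mem_permutations; apply/(perm_iotaP 0); exists Is.
rewrite -map_comp; apply/eq_in_map => i; rewrite (perm_mem IsP) mem_iota => iw /=.
by rewrite (nth_map 0).
Qed.

Lemma content_wordP (s : seq nat) : exists g : nat -> nat,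
  (forall x y, (g x < g y) = (x < y)) /\ perm_eq s (map g (content_word 0 (content s))).
Proof.
set u := sort leq (undup s).
have u_lt : sorted ltn u.
  by rewrite ltn_sorted_uniq_leq sort_uniq undup_uniq sort_sorted //; exact: leq_total.
(* The distinct letters in order, continued strictly increasingly beyond the last one. *)
pose g i := if i < size u then nth 0 u i else nth 0 u (size u).-1 + i.+1.
exists g; split.
  apply: strict_mono => i; rewrite /g.
  have [iu|ui] := ltnP i.+1 (size u).
    by rewrite (ltnW iu); move/(sortedP 0): u_lt; apply.
  case: ifP => iu; last by lia.
  have -> : (size u).-1 = i by lia.
  by lia.
apply: (@perm_trans _ (flatten [seq nseq (count_mem x s) x | x <- u])).
  rewrite perm_sym; apply: perm_trans (perm_count_undup s).
  by apply/perm_flatten/perm_map; rewrite perm_sort.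
rewrite /content -/u.
have gE j : j < size u -> g (0 + j) = nth 0 u j by rewrite /g => ->.
suff H v i : (forall j, j < size v -> g (i + j) = nth 0 v j) ->
    perm_eq (flatten [seq nseq (count_mem x s) x | x <- v])
            (map g (content_word i [seq count_mem x s | x <- v])) by exact: H.
elim: v i => //= x v IHv i {}gE.
have gi : g i = x by rewrite -[i]addn0 gE.
rewrite map_cat map_nseq gi perm_cat2l.
by apply: IHv => j jv; rewrite addSnnS gE.
Qed.

(** Order invariance allows the distinct letters to be replaced by 0, 1, 2, and so on; hence two
    such series of degree m are equal once they agree on one monomial for each composition of m. *)
Lemma word_series_content P (M : {mset nat}%mset) : order_invariant P ->
  word_series P M = Posz (count P (permutations (content_word 0 (content M)))).
Proof.
move=> Pinv; have [g [g_lt Mg]] := content_wordP M; rewrite /word_series; congr Posz.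
have /permP-> := perm_permutations Mg.
have gI : injective g.
  by move=> x y gxy; have := g_lt x y; have := g_lt y x; rewrite gxy ltnn; lia.
have /permP-> := perm_count_permutations (content_word 0 (content M)) gI.
by rewrite count_map; apply: eq_count => w /=; rewrite Pinv.
Qed.

Lemma content_pos s : all (leq 1) (content s).
Proof.
rewrite all_map; apply/allP => x; rewrite mem_sort mem_undup => xs /=.
by rewrite -has_count has_pred1.
Qed.

Lemma content_map (f : nat -> nat) s : injective f -> perm_eq (content (map f s)) (content s).
Proof.
move=> fI; rewrite /content; set F := fun x => count_mem x (map f s).
apply: (@perm_trans _ [seq F x | x <- map f (undup s)]).
  by apply: perm_map; rewrite perm_sort -undup_map_inj.
rewrite -map_comp (eq_map (_ : _ =1 fun x => count_mem x s)) => [|x].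
  by apply: perm_map; rewrite perm_sym perm_sort.
by rewrite /F /= count_map; apply: eq_count => y /=; rewrite inj_eq.
Qed.

Fixpoint compositions_rec (f m : nat) : seq (seq nat) :=
  if f is f'.+1 then
    if m is 0 then [:: [::]]
    else flatten [seq [seq c :: cs | cs <- compositions_rec f' (m - c)] | c <- iota 1 m]
  else if m is 0 then [:: [::]] else [::].

Definition compositions (m : nat) := compositions_rec m m.

Lemma mem_compositions cs : all (leq 1) cs -> cs \in compositions (sumn cs).
Proof.
rewrite /compositions.
suff H f : sumn cs <= f -> all (leq 1) cs -> cs \in compositions_rec f (sumn cs) by exact: H.
elim: cs f => [|c cs IHcs] [|f] //=; first by case: c => //=; lia.
case: c => // c; rewrite addSn ltnS => cf cs1.
apply/flatten_mapP; exists c.+1; first by rewrite mem_iota; lia.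
by apply: map_f; rewrite -addSn addKn IHcs //; lia.
Qed.

Definition schur_count (la cs : seq nat) : nat :=
  count (fun w => (size w == sumn la) && semistandard (reshape la w))
        (permutations (content_word 0 cs)).

(** The first comparison is the symmetry of the Schur function, the second is Gessel's expansion of
    it as the sum of Q_Des(T) over the standard tableaux T of shape [la]. *)
Definition schur_check (m : nat) (la : seq nat) : bool :=
  [&& is_partition la, sumn la == m &
  all (fun cs =>
    (schur_count la cs == schur_count la (sort geq cs)) &&
    (schur_count la cs ==
     sumn [seq count (Qpred m b) (permutations (content_word 0 cs)) | b <- syt_des la]))
  (compositions m)].

Lemma schur_check4 : all (schur_check 4) partitions4.
Proof. by vm_compute. Qed.

Lemma schur_check5 : all (schur_check 5) partitions5.
Proof. by vm_compute. Qed.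

Lemma tabs4E : tabs4 = [seq syt_des la | la <- partitions4].
Proof. by vm_compute. Qed.

Lemma tabs5E : tabs5 = [seq syt_des la | la <- partitions5].
Proof. by vm_compute. Qed.

Import GRing.Theory.

Lemma schur_countE la (M : {mset nat}%mset) : is_partition la ->
  schur la M = Posz (schur_count la (content M)).
Proof. by case/andP=> la_geq _; apply: word_series_content; exact: schur_invariant. Qed.

(** Disposes of the monomials of degree different from m, which the finite check does not see. *)
Lemma content_eq0 P (m : nat) cs : sumn cs != m ->
  count (fun w : seq nat => (size w == m) && P w) (permutations (content_word 0 cs)) = 0.
Proof.
move=> ncs; apply/eqP; rewrite -leqn0 leqNgt -has_count; apply/negP => /hasP[w].
rewrite mem_permutations => /perm_size; suff -> : size (content_word 0 cs) = sumn cs.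
  by move=> ->; rewrite (negPf ncs).
by elim: cs {ncs} 0 => //= c cs IHc i; rewrite size_cat size_nseq IHc.
Qed.

Lemma fseries_sumE (T : Type) (s : seq T) (F : T -> fseries) M :
  (\sum_(x <- s) F x)%R M = (\sum_(x <- s) F x M)%R.
Proof. by elim/big_rec2: _ => // x f y _ <-. Qed.

Lemma schur_Q m la : schur_check m la ->
  schur la = (\sum_(b <- syt_des la) Q m (bit_set b))%R.
Proof.
case/and3P=> la_part /eqP la_m /allP check; apply: funext => M.
rewrite fseries_sumE schur_countE //.
under eq_bigr do rewrite Q_bit_set (word_series_content _ (Qpred_invariant _ _)).
have [cm|ncm] := eqVneq (sumn (content M)) m.
  have : content M \in compositions m by rewrite -cm mem_compositions ?content_pos.
  move/check/andP=> [_ /eqP->].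
  by rewrite sumnE big_map -[LHS]natz natr_sum; apply: eq_bigr => b _; rewrite natz.
rewrite /schur_count content_eq0 ?la_m // big1 // => b _.
by rewrite content_eq0.
Qed.

Lemma perm_content s t : perm_eq s t -> content s = content t.
Proof.
move=> st; have -> : content s = [seq count_mem x t | x <- sort leq (undup s)].
  by apply: eq_map => x /=; rewrite (permP st).
congr map; apply/perm_sortP; [exact: leq_total|exact: leq_trans|exact: anti_leq|].
by apply: perm_undup => x; rewrite (perm_mem st).
Qed.

(** Permuting the variables rearranges the content of a monomial, and by the check a coefficient
    depends only on the sorted content. *)
Lemma schur_symmetric m la : schur_check m la -> is_symmetric (schur la).
Proof.
case/and3P=> la_part /eqP la_m /allP check s [/bij_inj sI _] M.
rewrite !schur_countE //; congr Posz.
have permc : perm_eq (content (seq_mset (map s M))) (content M).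
  by rewrite (perm_content (perm_eq_seq_mset _)); exact: content_map.
have [cm|ncm] := eqVneq (sumn (content M)) m; last first.
  rewrite /schur_count !content_eq0 ?la_m //.
  by rewrite sumnE (perm_big _ permc) -sumnE.
have c1 : content M \in compositions m by rewrite -cm mem_compositions ?content_pos.
have c2 : content (seq_mset (map s M)) \in compositions m.
  have e : sumn (content (seq_mset (map s M))) = m.
    by rewrite -cm sumnE (perm_big _ permc) -sumnE.
  by rewrite -e mem_compositions ?content_pos.
have /andP[/eqP-> _] := check _ c1; have /andP[/eqP-> _] := check _ c2.
congr schur_count; apply/perm_sortP => //.
- by move=> x y /=; exact: leq_total.
- by move=> y x z /= xy yz; exact: leq_trans yz xy.
- by move=> x y /= /anti_leq.
Qed.

Lemma is_symmetric_sum (T : eqType) (s : seq T) (F : T -> fseries) :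
  (forall x, x \in s -> is_symmetric (F x)) -> is_symmetric (\sum_(x <- s) F x)%R.
Proof.
by move=> symF f Sf M; rewrite !fseries_sumE; apply: eq_big_seq => x /symF; apply.
Qed.

Lemma schur_sum_positive m parts l : all (schur_check m) parts ->
  schur_sum [seq syt_des la | la <- parts] l ->
  let f := (\sum_(b <- l) Q m (bit_set b))%R in is_symmetric f /\ schur_positive f.
Proof.
move=> /allP check /schur_sumP[k lk] f.
set P := mask k parts.
have P_parts la : la \in P -> schur_check m la by move/mem_mask/check.
have fE : f = (\sum_(la <- P) schur la)%R.
  rewrite /f (perm_big _ lk) /= -map_mask -/P big_flatten /= big_map.
  by apply: eq_big_seq => la /P_parts/schur_Q.
rewrite fE; split; first by apply: is_symmetric_sum => la /P_parts/schur_symmetric.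
(* [schur_sum] uses each shape at most once, so the multiplicities are 1. *)
exists P, (fun=> 1); split; last by [].
by apply/allP => la /P_parts/and3P[].
Qed.

(** * The axioms of dual equivalences *)

Lemma finite_words (L : seq (nat * nat)) n :
  finite_set [set c : seq (nat * nat) | size c = n /\ all (mem L) c].
Proof.
pose W := iter n (fun W => [seq t :: c | t <- L, c <- W]) [:: [::]].
apply: (@sub_finite_set _ _ [set` W]) (finite_seq W) => c [sc cL]; rewrite /W -sc /=.
elim: c {sc} cL => //= t c IHc /andP[tL /IHc cW].
exact: allpairs_f.
Qed.

(** Let p be the point sent to a by the product of the entries before (a, b). The next product sends
    p to b, and both products are below [z], so a and b lie between p and z p. If p were at least
    [N], both would equal p. This bounds the letters of all chains and makes their set finite. *)
Lemma gb_word_letters z c N t : gb_word c -> chain_perm c = z ->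
  (forall x, N <= x -> z x = x) -> t \in c -> t.1 < N /\ t.2 < N.
Proof.
case: t => a b c_gb cz zN /splitPr cE; move: cE c_gb cz => [s s'] c_gb cz /=.
have zI : injective z by rewrite -cz; exact: chain_perm_inj.
move: c_gb => /gb_steps_cat[s_gb /= [/= t12 le_t s'_gb]].
have [x' _ xK] := chain_perm_bij s; have sp : chain_perm s (x' a) = a by rewrite xK.
have le_z := gb_steps_le s'_gb.
have zE : chain_perm s' \o (transp_fun (a, b) \o (chain_perm s \o id)) = z.
  by rewrite -cz chain_perm_cat chain_perm_cons.
rewrite zE in le_z; set p := x' a in sp.
have tp : (transp_fun (a, b) \o (chain_perm s \o id)) p = b.
  by rewrite /= sp /transp_fun eqxx.
have le_s : gb_le (chain_perm s) z by apply: gb_le_trans le_t le_z.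
have /gb_leP[/(_ p)] := le_z; rewrite tp => z1 _.
have /gb_leP[/(_ p)] := le_s; rewrite sp => z2 _.
have pN : p < N.
  by rewrite ltnNge; apply/negP => /zN zp; move: z1 z2; rewrite zp => -[]-[] ? ? -[]-[]; lia.
have zpN : z p < N.
  rewrite ltnNge; apply/negP => le_zp; have := zN _ le_zp => /zI.
  by lia.
by case: z1 => -[? ?]; case: z2 => -[? ?]; lia.
Qed.

Lemma size_moves t1 t2 t3 v : v \in moves t1 t2 t3 -> size v = 3.
Proof.
case: t1 t2 t3 => [p q] [r s] [x y]; rewrite mem_moves => /or3P[].
- by rewrite /movesB mem_cat !mem_when => /orP[]/andP[_ /eqP->].
- rewrite /movesA; do ![case: ifP => _ //];
    by rewrite mem_cat !mem_when => /orP[]/andP[_ /eqP->].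
by rewrite /movesC !mem_cat !mem_when => /or4P[]/andP[_ /eqP->].
Qed.

Lemma size_phi_at k w : size (phi_at k w) = size w.
Proof.
elim: k w => [|k IHk] [|t1 w] //=; last by rewrite IHk.
case: w => [|t2 [|t3 w]] //=; case: ifP => // _.
case movesE: (moves _ _ _) => [|v l] //.
by rewrite size_cat (@size_moves t1 t2 t3) // movesE mem_head.
Qed.

Lemma phi_atC k l w : k + 3 <= l -> l + 3 <= size w ->
  phi_at k (phi_at l w) = phi_at l (phi_at k w).
Proof.
move=> kl lw; have kw : k + 3 <= size w by lia.
have [s [t1 [t2 [t3 [r [sk wE]]]]]] := split3 kw.
set u := [:: t1; t2; t3] in wE.
have phi_l x : size x = 3 -> phi_at l (s ++ x ++ r) = s ++ x ++ phi_at (l - (k + 3)) r.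
  move=> sx; have := @phi_at_cat (s ++ x) r [::] (l - (k + 3)).
  rewrite !cats0 -!catA size_cat sk sx subnKC // => -> //.
  by move: lw; rewrite wE !size_cat sk /=; lia.
have phi_k x r' : size x = 3 -> phi_at k (s ++ x ++ r') = s ++ phi_at 0 x ++ r'.
  by move=> sx; rewrite -sk -[size s]addn0 phi_at_cat ?sx.
by rewrite wE phi_l // !phi_k // phi_l // size_phi_at.
Qed.

Lemma gb_word4_left t1 t2 t3 t4 u1 u2 u3 : gb_word [:: t1; t2; t3; t4] ->
  phi_at 0 [:: t1; t2; t3] = [:: u1; u2; u3] -> [:: u1; u2; u3] <> [:: t1; t2; t3] ->
  desb t3 t4 <> desb u3 t4 -> phi_at 1 [:: t1; t2; t3; t4] <> [:: t1; t2; t3; t4].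
Proof.
move=> w_gb uE ne d; apply/movedP; have := gb_word_check4 w_gb erefl.
have vE : phi_at 0 [:: t1; t2; t3; t4] = [:: u1; u2; u3; t4].
  by have := @phi_at_cat [::] [:: t1; t2; t3] [:: t4] 0 isT; rewrite uE.
have m0 : moved 0 [:: t1; t2; t3; t4].
  by apply/movedP; rewrite vE => -[*]; apply: ne; congr [:: _; _; _].
rewrite /check4 m0 vE same_bitE (introF eqP d); case: class_schur => //.
by case: (moved 1 _).
Qed.

Lemma gb_word4_right t0 t1 t2 t3 u1 u2 u3 : gb_word [:: t0; t1; t2; t3] ->
  phi_at 0 [:: t1; t2; t3] = [:: u1; u2; u3] -> [:: u1; u2; u3] <> [:: t1; t2; t3] ->
  desb t0 t1 <> desb t0 u1 -> phi_at 0 [:: t0; t1; t2; t3] <> [:: t0; t1; t2; t3].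
Proof.
move=> w_gb uE ne d; apply/movedP; have := gb_word_check4 w_gb erefl.
have vE : phi_at 1 [:: t0; t1; t2; t3] = [:: t0; u1; u2; u3] by rewrite -uE.
have m1 : moved 1 [:: t0; t1; t2; t3].
  by apply/movedP; rewrite vE => -[*]; apply: ne; congr [:: _; _; _].
rewrite /check4 m1 vE same_bitE (introF eqP d); case: class_schur => //.
by case: (if moved 0 _ then _ else _).
Qed.

Lemma exactly_one_bool (P P' : Prop) (b b' : bool) : (P <-> b) -> (P' <-> b') ->
  exactly_one P P' -> b <> b'.
Proof.
move=> Pb Pb'; rewrite /exactly_one Pb Pb'.
by case: b {Pb}; case: b' {Pb'} => // -[] [].
Qed.

Section Chains.

Variables (z : nat -> nat) (n : nat).
Hypotheses (Sz : Sinf z) (rank_z : has_rank z n).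

Local Notation C := (chains z n).

Lemma chainsP c : C c <-> [/\ size c = n, gb_word c & chain_perm c = z].
Proof. exact: is_chainP. Qed.

Lemma chains_phi_at k c : C c -> C (phi_at k c).
Proof.
case/chainsP=> sc c_gb cz; have [gb perm size _] := phi_at_gb k c_gb.
by apply/chainsP; rewrite perm size.
Qed.

Lemma chain_phi_phi_at i c : 2 <= i <= n - 1 -> C c -> chain_phi i c = phi_at (i - 2) c.
Proof. by move=> i_n /chainsP[sc c_gb _]; apply: chain_phiE; rewrite ?sc. Qed.

Lemma chains_window k m c : C c -> k + m <= n -> exists s w s',
  [/\ c = s ++ w ++ s', size s = k, size w = m & gb_word w].
Proof.
move=> /chainsP[sc c_gb _] km.
have cE : c = take k c ++ take m (drop k c) ++ drop m (drop k c).
  by rewrite !cat_take_drop.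
exists (take k c), (take m (drop k c)), (drop m (drop k c)); split=> //.
- by rewrite size_take_min; lia.
- by rewrite size_take_min size_drop; lia.
by apply: (@gb_word_factor (take k c) _ (drop m (drop k c))); rewrite -cE.
Qed.

Lemma chains_subst s v w s' : C (s ++ w ++ s') -> gb_word v ->
  chain_perm v = chain_perm w -> size v = size w -> C (s ++ v ++ s').
Proof.
move=> /chainsP[sc c_gb cz] v_gb vw sz; apply/chainsP; split.
- by rewrite -sc !size_cat sz.
- by apply: gb_word_subst c_gb.
by rewrite -cz !chain_perm_cat vw.
Qed.

Lemma chains_setting : setting n C chain_Des chain_phi.
Proof.
split=> [|c /chainsP[sc _ _] j []|i c i_n Cc]; last 2 first.
- by rewrite sc.
- rewrite !chain_phi_phi_at //; last exact: chains_phi_at.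
  split; first exact: chains_phi_at.
  by have /chainsP[_ c_gb _] := Cc; have [] := phi_at_gb (i - 2) c_gb.
have /SinfP[_ [N zN]] := Sz.
apply: sub_finite_set (finite_words [seq (a, b) | a <- iota 0 N, b <- iota 0 N] n).
move=> c /chainsP[sc c_gb cz] /=; split=> //; apply/allP => -[a b] tc.
have [/= aN bN] := gb_word_letters c_gb cz zN tc.
by apply/allpairsP; exists (a, b); rewrite !mem_iota.
Qed.

Lemma chains_DesE s w s' j : j.+1 < size w ->
  chain_Des (s ++ w ++ s') (size s + j.+1) <-> nth false (des_bits w) j.
Proof.
move=> jw; rewrite -(nth_des_bits_cat s s' jw); split=> [/chain_DesE[_]|d].
  by rewrite addnS.
by apply/chain_DesE; rewrite addnS.
Qed.

Lemma chains_window3 i c : 2 <= i <= n - 1 -> C c -> exists s t1 t2 t3 s',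
  [/\ i = (size s).+2, c = s ++ [:: t1; t2; t3] ++ s', gb_word [:: t1; t2; t3],
      chain_phi i c = s ++ phi_at 0 [:: t1; t2; t3] ++ s' &
      (chain_Des c (i - 1) <-> desb t1 t2) /\ (chain_Des c i <-> desb t2 t3)].
Proof.
case: i => [|[|k]] // i_n Cc.
have kn : k + 3 <= n by lia.
have [s [w [s' [cE ss sw w_gb]]]] := chains_window Cc kn.
case: w sw w_gb cE => [|t1 [|t2 [|t3 [|? ?]]]] // _ w_gb cE.
exists s, t1, t2, t3, s'; split=> //; first by rewrite ss.
- by rewrite chain_phi_phi_at // subSS subn1 -ss cE phi_at_window.
have e1 : k.+2 - 1 = size s + 1 by lia.
have e2 : k.+2 = size s + 2 by lia.
by split; [rewrite e1 | rewrite e2]; rewrite cE chains_DesE.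
Qed.

Lemma phi_at0_neq s t1 t2 t3 s' : gb_word [:: t1; t2; t3] ->
  s ++ phi_at 0 [:: t1; t2; t3] ++ s' <> s ++ [:: t1; t2; t3] ++ s' ->
  exists u1 u2 u3, [/\ phi_at 0 [:: t1; t2; t3] = [:: u1; u2; u3],
    desb u1 u2 = ~~ desb t1 t2 & desb u2 u3 = ~~ desb t2 t3].
Proof.
move=> w_gb; have [e|ne _] := eqVneq (desb t1 t2) (desb t2 t3).
  by rewrite phi_at0_id.
have [u1 [u2 [u3 [movesE _ _ d12 d23]]]] := gb_word3 w_gb ne.
by exists u1, u2, u3; rewrite /phi_at same_bitE (negPf ne) movesE.
Qed.

Lemma chains_axiom_i : axiom_i n C chain_Des chain_phi.
Proof.
move=> i c i_n Cc.
have [s [t1 [t2 [t3 [s' [_ cE w_gb -> [-> ->]]]]]]] := chains_window3 i_n Cc.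
rewrite cE; split=> [e|[d12 d23]]; last first.
  by rewrite phi_at0_id //; apply/idP/idP.
have [e12|ne] := eqVneq (desb t1 t2) (desb t2 t3); first by rewrite e12.
have [u1 [u2 [u3 [movesE _ _ d12 _]]]] := gb_word3 w_gb ne.
have phiE : phi_at 0 [:: t1; t2; t3] = [:: u1; u2; u3].
  by rewrite /phi_at same_bitE (negPf ne) movesE.
move/eqP: e; rewrite phiE eqseq_cat // eqxx andTb eqseq_cat // => /andP[/eqP[e1 e2 _] _].
by move: d12; rewrite e1 e2; case: desb.
Qed.

Lemma chain_Des_window s u v s' j : size u = size v ->
  j < size s \/ size s + size u < j ->
  chain_Des (s ++ u ++ s') j <-> chain_Des (s ++ v ++ s') j.
Proof.
move=> uv j_out; have nthE p : p < size s \/ size s + size u <= p ->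
    nth (0, 0) (s ++ u ++ s') p = nth (0, 0) (s ++ v ++ s') p.
  rewrite !nth_cat uv; case: ltnP => // sp; case: ltnP => // pv; lia.
case: j j_out => [|j] j_out; first by split=> /chain_DesE[].
split=> /chain_DesE[_]; rewrite nth_des_bits => /andP[sj d]; apply/chain_DesE;
  (split; first by []); rewrite nth_des_bits.
  by rewrite -!nthE ?d ?andbT; move: sj; rewrite ?size_cat uv; lia.
by rewrite !nthE ?d ?andbT; move: sj; rewrite ?size_cat uv; lia.
Qed.

Lemma chains_axiom_ii : axiom_ii n C chain_Des chain_phi.
Proof.
move=> i c i_n Cc.
have [s [t1 [t2 [t3 [s' [iE cE w_gb phiE [D1 D2]]]]]]] := chains_window3 i_n Cc.
have Cphi := (chains_phi_at (i - 2) Cc); rewrite -chain_phi_phi_at // in Cphi.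
rewrite phiE {1}cE => /nesym/(phi_at0_neq w_gb)[u1 [u2 [u3 [uE d12 d23]]]].
rewrite phiE uE in Cphi *.
have une : [:: u1; u2; u3] <> [:: t1; t2; t3].
  by move=> [e1 e2 _]; move: d12; rewrite e1 e2; case: desb.
have e1 : i - 1 = size s + 1 by lia.
have e2 : i = size s + 2 by lia.
have uD1 : chain_Des (s ++ [:: u1; u2; u3] ++ s') (i - 1) <-> desb u1 u2.
  by rewrite e1 chains_DesE.
have uD2 : chain_Des (s ++ [:: u1; u2; u3] ++ s') i <-> desb u2 u3.
  by rewrite e2 chains_DesE.
split.
- move=> j; rewrite !inE !negb_or => /and4P[/eqP j1 /eqP j2 /eqP j3 /eqP j4].
  by rewrite cE; apply: chain_Des_window => //=; lia.
- move=> j; rewrite !inE => /orP[/eqP->|/eqP->].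
    by rewrite /exactly_one D1 uD1 d12; case: desb; [left|right].
  by rewrite /exactly_one D2 uD2 d23; case: desb; [left|right].
(* For (ii.c) the window is enlarged by its left neighbour; if there is none, [i - 2 = 0], which is
   never a descent. *)
- case/lastP: s iE cE phiE D1 D2 uD1 uD2 e1 e2 Cphi => [|s t0] iE cE _ _ _ _ _ _ _ Cphi.
    by rewrite iE => -[[/chain_DesE[]]|[_ /chain_DesE[]]].
  rewrite size_rcons in iE; rewrite -cats1 -!catA in cE Cphi *.
  have e1 : i - 2 = size s + 1 by lia.
  have w4_gb : gb_word [:: t0; t1; t2; t3].
    have /chainsP[_ + _] := Cc; rewrite cE.
    exact: (@gb_word_factor s [:: t0; t1; t2; t3] s').
  rewrite e1 cE => ex; have /= d := exactly_one_bool
    (@chains_DesE s [:: t0; t1; t2; t3] s' 0 isT)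
    (@chains_DesE s [:: t0; u1; u2; u3] s' 0 isT) ex.
  have Cc' : C (s ++ [:: t0; t1; t2; t3] ++ s') by rewrite -[_ ++ _ ++ _]cE.
  rewrite chain_phi_phi_at //; last lia.
  rewrite (_ : i - 1 - 2 = size s + 0); last lia.
  rewrite -/([:: t0; t1; t2; t3] ++ s') phi_at_cat //.
  move=> /eqP; rewrite eqseq_cat // eqxx andTb eqseq_cat ?size_phi_at // => /andP[/eqP e _].
  exact: (gb_word4_right w4_gb uE une d (esym e)).
(* For (ii.d), a window without right neighbour has [i + 1] equal to the length of the chain, which
   is not a descent either. *)
case: s' cE phiE D1 D2 uD1 uD2 Cphi => [|t4 s'] cE _ _ _ _ _ Cphi.
  have /chainsP[sc _ _] := Cc; move: sc; rewrite cE size_cat /= => sc.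
  by rewrite /exactly_one => -[[/chain_DesE[_]]|[_ /chain_DesE[_]]];
    rewrite nth_des_bits size_cat /=; lia.
have e3 : i + 1 = size s + 3 by lia.
have w4_gb : gb_word [:: t1; t2; t3; t4].
  have /chainsP[_ + _] := Cc; rewrite cE.
  exact: (@gb_word_factor s [:: t1; t2; t3; t4] s').
rewrite e3 cE => ex; have /= d := exactly_one_bool
  (@chains_DesE s [:: t1; t2; t3; t4] s' 2 isT)
  (@chains_DesE s [:: u1; u2; u3; t4] s' 2 isT) ex.
have Cc' : C (s ++ [:: t1; t2; t3; t4] ++ s') by rewrite -[_ ++ _ ++ _]cE.
have sn : size s + 4 <= n by have /chainsP[<- _ _] := Cc'; rewrite !size_cat /=; lia.
rewrite chain_phi_phi_at //; last lia.
rewrite (_ : size s + 3 - 2 = size s + 1); last lia.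
rewrite -[[:: t1, t2, t3, t4 & s']]/([:: t1; t2; t3; t4] ++ s') phi_at_cat //.
move=> /eqP; rewrite eqseq_cat // eqxx andTb eqseq_cat ?size_phi_at // => /andP[/eqP e _].
exact: (gb_word4_left w4_gb uE une d (esym e)).
Qed.

Lemma chains_axiom_iii : axiom_iii n C chain_phi.
Proof.
move=> i j c i_n j_n ij Cc.
rewrite !chain_phi_phi_at //; do ?exact: chains_phi_at.
have /chainsP[sc _ _] := Cc.
case/orP: ij => ij; first by apply: phi_atC; rewrite ?sc; lia.
by apply/esym/phi_atC; rewrite ?sc; lia.
Qed.

End Chains.

(** * Equivalence classes and the conditions (iv.a) and (iv.b) *)

Lemma bfsP (P : seq (nat * nat) -> Prop) K f seen todo cl :
  (forall k x, k \in K -> P x -> P (phi_at k x)) -> uniq seen ->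
  (forall x k, x \in seen -> k \in K -> phi_at k x \in seen ++ todo) ->
  (forall x, x \in seen ++ todo -> P x) -> bfs K f seen todo = Some cl ->
  [/\ uniq cl, {subset seen ++ todo <= cl},
      forall x k, x \in cl -> k \in K -> phi_at k x \in cl & forall x, x \in cl -> P x].
Proof.
move=> PK; elim: f seen todo => [|f IHf] seen [|x todo] //= seen_uniq seenK seenP.
- by case=> <-; rewrite cats0 in seenK seenP *; split.
- by case=> <-; rewrite cats0 in seenK seenP *; split.
rewrite (_ : has _ _ = (x \in seen)); last first.
  by rewrite -has_pred1; apply: eq_has => y /=; rewrite word_eqbE eq_sym.
have x_in : x \in seen ++ x :: todo by rewrite mem_cat mem_head orbT.
case: ifP => [x_seen|x_nseen] /IHf[].
- exact: seen_uniq.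
- move=> y k y_seen kK; have := seenK y k y_seen kK.
  by rewrite !mem_cat inE => /or3P[->|/eqP->|->]; rewrite ?x_seen ?orbT.
- move=> y; rewrite mem_cat => y_in; apply: seenP.
  by rewrite mem_cat inE orbCA y_in orbT.
- move=> ? sub ? ?; split=> // y; rewrite mem_cat inE => /or3P[ys|/eqP->|yt]; apply: sub;
    by rewrite mem_cat ?ys ?x_seen ?yt ?orbT.
- by rewrite /= x_nseen.
- move=> y k; rewrite inE => /predU1P[-> kK|y_seen kK].
    by rewrite inE !mem_cat (map_f (fun k => phi_at k x)) // orbT orbT.
  have := seenK y k y_seen kK.
  by rewrite inE !mem_cat inE => /or3P[->|->|->]; rewrite ?orbT.
- move=> y; rewrite inE !mem_cat => /or4P[/eqP->|ys|/mapP[k kK ->]|yt].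
  + exact: seenP.
  + by apply: seenP; rewrite mem_cat ys.
  + by apply: PK => //; exact: seenP.
  by apply: seenP; rewrite mem_cat inE yt !orbT.
move=> ? sub ? ?; split=> // y; rewrite mem_cat inE => /or3P[ys|/eqP->|yt]; apply: sub;
  by rewrite inE !mem_cat ?ys ?eqxx ?yt ?orbT.
Qed.

Lemma Des_ij_window i j (s v s' : seq (nat * nat)) : 2 <= i ->
  size s = i - 2 -> size v = j - i + 3 ->
  i <= j -> Des_ij chain_Des i j (s ++ v ++ s') = bit_set (des_bits v).
Proof.
move=> i2 ss sv ij; apply/seteqP; split=> x /=.
  case=> k [Dk /= kij] <-.
  have ke : k = size s + (k - (i - 1)).+1 by lia.
  rewrite {1}ke in Dk; move/chains_DesE: Dk => d; split; first by lia.
  by rewrite (_ : _.-1 = k - (i - 1)); [apply: d; lia | lia].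
case; case: x => // x _ d; have xv : x.+1 < size v.
  by move: d; rewrite nth_des_bits => /andP[].
exists (size s + x.+1); last by lia.
by split; [apply/chains_DesE | rewrite /=; lia].
Qed.

Lemma check5P w : check5 w ->
  [/\ class_schur tabs5 [:: 0; 1; 2] w, class_eq w,
      flat_from 0 2 feat_last w & flat_from 2 0 feat_first w].
Proof. by rewrite /check5 => /andP[/andP[/andP[]]]. Qed.

Lemma class_schurP tabs K w : class_schur tabs K w -> exists2 cl,
  bfs K 70 [::] [:: w] = Some cl & schur_sum tabs (map des_bits cl).
Proof.
by rewrite /class_schur; set b := bfs _ _ _ _; case: b => [cl|//]; exists cl.
Qed.

Section Classes.

Variables (z : nat -> nat) (n : nat).
Hypotheses (Sz : Sinf z) (rank_z : has_rank z n).

Local Notation C := (chains z n).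

Lemma chain_phi_window k (s w s' : seq (nat * nat)) : C (s ++ w ++ s') -> k + 3 <= size w ->
  chain_phi (size s + 2 + k) (s ++ w ++ s') = s ++ phi_at k w ++ s'.
Proof.
move=> Cc kw; have /(chainsP Sz rank_z)[sc _ _] := Cc.
rewrite (chain_phi_phi_at Sz rank_z) //; last by rewrite -sc !size_cat; lia.
by rewrite (_ : _ - 2 = size s + k); [rewrite phi_at_cat | lia].
Qed.

Lemma class_ij_window i j (s w s' : seq (nat * nat)) cl : 2 <= i -> i <= j <= n - 1 ->
  C (s ++ w ++ s') -> size s = i - 2 -> size w = j - i + 3 ->
  bfs (iota 0 (j - i + 1)) 70 [::] [:: w] = Some cl ->
  uniq cl /\ class_ij C chain_phi i j (s ++ w ++ s') = [set` [seq s ++ v ++ s' | v <- cl]].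
Proof.
move=> i2 ij Cc ss sw bfs_cl; set c := s ++ w ++ s' in Cc *.
pose P v := [/\ gb_word v, chain_perm v = chain_perm w, size v = size w &
                class_ij C chain_phi i j c (s ++ v ++ s')].
have CP v : P v -> C (s ++ v ++ s').
  by case=> v_gb vw sv _; apply: (chains_subst Sz rank_z Cc).
have phiP v k : k \in iota 0 (j - i + 1) -> P v ->
    chain_phi (i + k) (s ++ v ++ s') = s ++ phi_at k v ++ s'.
  rewrite mem_iota => kij Pv; have [_ _ sv _] := Pv.
  rewrite (_ : i + k = size s + 2 + k); last lia.
  by rewrite chain_phi_window //; [exact: CP | lia].
have PK k v : k \in iota 0 (j - i + 1) -> P v -> P (phi_at k v).
  move=> kij Pv; have [v_gb vw sv v_class] := Pv.
  have [v'_gb v'w sv' _] := phi_at_gb k v_gb.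
  split=> //; rewrite ?v'w ?sv' //.
  apply: Relation_Operators.rst_trans v_class _; apply: Relation_Operators.rst_step.
  split; first exact: CP.
  exists (i + k); last by rewrite phiP.
  by move: kij; rewrite mem_iota; lia.
have w_gb : gb_word w by have /(chainsP Sz rank_z)[_ /gb_word_factor] := Cc.
have Pw : P w by split=> //; exact: Relation_Operators.rst_refl.
have [] := bfsP PK _ _ _ bfs_cl => // [x|cl_uniq sub clK clP].
  by rewrite inE => /eqP->.
split=> //; apply/seteqP; split=> [a|a /= /mapP[v /clP[_ _ _ v_class] ->] //].
have H p q : Relation_Operators.clos_refl_sym_trans (seq (nat * nat))
    (fun x y => C x /\ exists2 k, i <= k <= j & y = chain_phi k x) p q ->
    (p \in [seq s ++ v ++ s' | v <- cl]) <-> (q \in [seq s ++ v ++ s' | v <- cl]).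
  elim=> [x1 x2 [Cx [k kij ->]]|//|x1 x2 _ [xy yx] //|x1 x2 x3 _ [xy yx] _ [yt ty]].
  - have kn : k - i \in iota 0 (j - i + 1) by rewrite mem_iota; lia.
    have stable y : y \in [seq s ++ v ++ s' | v <- cl] ->
      chain_phi k y \in [seq s ++ v ++ s' | v <- cl].
      case/mapP=> v v_cl ->; have -> : k = i + (k - i) by lia.
      by rewrite phiP //; [apply: map_f; exact: clK | exact: clP].
    (* Generators can be followed backwards because each involution, applied twice, returns to
       [x1]. *)
    split=> [/stable //|/stable].
    have [_ _ /(_ k x1)[|//|_ ->//]] := chains_setting Sz rank_z.
    by lia.
  by split=> [/xy/yt|/ty/yx].
move/H => [+ _]; apply; apply/mapP; exists w => //.
by apply: sub; rewrite inE.
Qed.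

Lemma class_series_window i j (s w s' : seq (nat * nat)) cl : 2 <= i -> i <= j <= n - 1 ->
  C (s ++ w ++ s') -> size s = i - 2 -> size w = j - i + 3 ->
  bfs (iota 0 (j - i + 1)) 70 [::] [:: w] = Some cl ->
  class_series C chain_Des chain_phi i j (s ++ w ++ s') =
  (\sum_(b <- map des_bits cl) Q (j - i + 3) (bit_set b))%R.
Proof.
move=> i2 ij Cc ss sw bfs_cl.
have [cl_uniq classE] := class_ij_window i2 ij Cc ss sw bfs_cl.
rewrite /class_series classE -fsbig_seq; last first.
  rewrite map_inj_in_uniq // => v v' _ _ e.
  have sv : size v = size v' by move/(congr1 size): e; rewrite !size_cat => /addnI/addIn.
  by move/eqP: e; rewrite !eqseq_cat // => /and3P[_ /eqP].
rewrite !big_map; apply: eq_big_seq => v v_cl; congr Q.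
apply: Des_ij_window => //; last by lia.
suff -> : size v = size w by [].
have [] := @bfsP (fun v => size v = size w) _ _ _ _ _ _ _ _ _ bfs_cl => //.
- by move=> k x _; rewrite size_phi_at.
- by move=> x; rewrite inE => /eqP->.
by move=> _ _ _; exact.
Qed.

Lemma class_series_schur m parts i j c : all (schur_check m) parts ->
  2 <= i -> i <= j <= n - 1 -> m = j - i + 3 -> C c ->
  (forall w, gb_word w -> size w = m ->
     class_schur [seq syt_des la | la <- parts] (iota 0 (j - i + 1)) w) ->
  is_symmetric (class_series C chain_Des chain_phi i j c) /\
  schur_positive (class_series C chain_Des chain_phi i j c).
Proof.
move=> parts_ok i2 ij mE Cc check.
have [|s [w [s' [cE ss sw w_gb]]]] := @chains_window z n Sz rank_z (i - 2) m c Cc; first lia.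
have [cl bfs_cl schur] := class_schurP (check w w_gb sw).
rewrite cE in Cc *; rewrite (@class_series_window i j s w s' cl) -?mE //.
exact: (schur_sum_positive parts_ok schur).
Qed.

Lemma chains_axiom_iva : axiom_iva n C chain_Des chain_phi.
Proof.
move=> i j c i2 ij jn Cc.
have ij' : i <= j <= n - 1 by lia.
have [ji|ji] : j - i = 1 \/ j - i = 2 by lia.
  apply: (class_series_schur schur_check4) => //; first by rewrite ji.
  rewrite ji -tabs4E => w w_gb sw; have := gb_word_check4 w_gb sw.
  by rewrite /check4; case: ifP.
apply: (class_series_schur schur_check5) => //; first by rewrite ji.
by rewrite ji -tabs5E => w w_gb sw; have [] := check5P (gb_word_check5 w_gb sw).
Qed.

Lemma class_eqP w : class_eq w -> phi_at 1 w <> w -> phi_at 0 w <> w -> phi_at 2 w <> w ->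
  phi_at 0 (phi_at 1 w) <> phi_at 1 w -> phi_at 2 (phi_at 1 w) <> phi_at 1 w ->
  exists cl cl', [/\ bfs [:: 0; 1] 70 [::] [:: take 4 w] = Some cl,
    bfs [:: 0; 1] 70 [::] [:: drop 1 w] = Some cl' &
    perm_eq (map des_bits cl) (map des_bits cl')].
Proof.
move=> eq_w /movedP n1 /movedP n0 /movedP n2 /movedP m0 /movedP m2.
move: eq_w; rewrite /class_eq; cbv zeta; rewrite n1 n0 n2 m0 m2.
set b := bfs _ _ _ [:: take 4 w]; set b' := bfs _ _ _ [:: drop 1 w].
case: b b' => [cl|//] [cl'|//].
case sub: (subtract _ _) => [[|? ?]|] // _; exists cl, cl'; split=> //.
by have := subtractP sub; rewrite cats0 perm_sym.
Qed.

Lemma chains_axiom_ivb : axiom_ivb n C chain_Des chain_phi.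
Proof.
move=> i c i3 i_n Cc.
have [|s [w [s' [cE ss sw w_gb]]]] := @chains_window z n Sz rank_z (i - 3) 5 c Cc; first lia.
have [_ eq_w _ _] := check5P (gb_word_check5 w_gb sw).
have Cphi : C (s ++ phi_at 1 w ++ s').
  have [v_gb vw sv _] := phi_at_gb 1 w_gb.
  by rewrite cE in Cc; exact: (chains_subst Sz rank_z Cc).
have phiE k v : k <= 2 -> size v = 5 -> C (s ++ v ++ s') ->
    chain_phi (i - 1 + k) (s ++ v ++ s') = s ++ phi_at k v ++ s'.
  move=> k2 sv Cv; rewrite (_ : _ + k = size s + 2 + k); last lia.
  by rewrite chain_phi_window ?sv //; lia.
rewrite cE in Cc *.
have e0 : i - 1 = i - 1 + 0 by lia.
have e1 : i = i - 1 + 1 by lia.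
have e2 : i + 1 = i - 1 + 2 by lia.
have neq k v : k <= 2 -> size v = 5 -> C (s ++ v ++ s') ->
    chain_phi (i - 1 + k) (s ++ v ++ s') <> s ++ v ++ s' -> phi_at k v <> v.
  by move=> k2 sv Cv + e; rewrite phiE // e.
have phi1E : chain_phi i (s ++ w ++ s') = s ++ phi_at 1 w ++ s' by rewrite {1}e1 phiE.
have sv : size (phi_at 1 w) = 5 by rewrite size_phi_at.
rewrite phi1E => n1 n0 n2 m0 m2.
have [|||||cl [cl' [bfs_cl bfs_cl' clcl']]] := class_eqP eq_w.
- by apply: neq => //; rewrite -e1 phi1E.
- by apply: neq => //; rewrite -e0.
- by apply: neq => //; rewrite -e2.
- by apply: neq => //; rewrite -e0.
- by apply: neq => //; rewrite -e2.
(* phi_(i-1) and phi_i act on the first four entries of [w], phi_i and phi_(i+1) on the last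
   four. *)
have wE : s ++ w ++ s' = s ++ take 4 w ++ (drop 4 w ++ s').
  by rewrite [in RHS](catA (take 4 w)) cat_take_drop.
have wE' : s ++ w ++ s' = (s ++ take 1 w) ++ drop 1 w ++ s'.
  by rewrite -catA [in RHS](catA (take 1 w)) cat_take_drop.
have Cc1 := Cc; have Cc2 := Cc; rewrite wE in Cc1; rewrite wE' in Cc2.
have ji1 : i - (i - 1) = 1 by lia.
have ji2 : i + 1 - i = 1 by lia.
rewrite {1}wE (@class_series_window (i - 1) i s (take 4 w) _ cl) ?ji1 //; try lia; last first.
  by rewrite size_take_min sw.
rewrite wE' (@class_series_window i (i + 1) (s ++ take 1 w) (drop 1 w) _ cl') ?ji2 //; try lia.
- by rewrite (perm_big _ clcl').
- by rewrite size_cat size_take_min sw; lia.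
by rewrite size_drop sw.
Qed.

End Classes.

(** * Flat chains and the condition (iv.c) *)

(** Lowering a threshold that is not itself a label changes no comparison with a label. So it can be
    lowered until it is one, or until it is below all of them. *)
Lemma cut_exists F thr : exists2 cut, cut \in None :: [seq Some f.1 | f <- F] &
  cut_pattern F cut = cut_pattern F thr.
Proof.
case: thr => [B|]; last by exists None; rewrite ?mem_head.
elim: B => [|B [cut cut_in cutE]].
  have [F0|nF0] := boolP (0 \in [seq f.1 | f <- F]).
    by exists (Some 0); rewrite // inE /= (map_comp Some) map_f.
  exists None; first exact: mem_head.
  apply/eq_in_map => f fF /=; rewrite nat_ltbE lt0n; congr (_ != _).
  by apply/esym/eqP => f0; case/negP: nF0; rewrite -f0 map_f.
have [FB|nFB] := boolP (B.+1 \in [seq f.1 | f <- F]).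
  by exists (Some B.+1); rewrite // inE /= (map_comp Some) map_f.
exists cut => //; rewrite cutE; apply/eq_in_map => f fF /=; rewrite !nat_ltbE.
have : f.1 != B.+1 by apply: contraNneq nFB => <-; rewrite map_f.
by case: f {fF} => l b /= nl; congr (_ != _); lia.
Qed.

(** The successor of each listed word is listed or is the start, which is listed too; hence no
    iterate leaves the list. *)
Lemma orbit_fromP p f x s t : orbit_from p f x x = Some s ->
  iter t (fun y => phi_at p (phi_at 1 y)) x \in s.
Proof.
have H y s' : orbit_from p f x y = Some s' -> y \in s' /\ forall v, v \in s' ->
    phi_at p (phi_at 1 v) \in s' \/ phi_at p (phi_at 1 v) = x.
  elim: f y s' => // f IHf y s'; rewrite [orbit_from _ _ _ _]/= word_eqbE.
  case: eqP => [yx [<-]|_].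
    by split=> [|v]; rewrite !inE // => /eqP->; right.
  case orb: (orbit_from _ _ _ _) => [s1|//] [<-].
  have [y1 s1P] := IHf _ _ orb; split=> [|v]; first exact: mem_head.
  rewrite !inE => /predU1P[->|/s1P[->|]]; [by rewrite y1 orbT; left| |by right].
  by rewrite orbT; left.
move=> /H[xs sP]; elim: t => //= t IHt.
by case: (sP _ IHt) => // ->.
Qed.

Definition unfixed_at (feat : seq (nat * nat) -> option (nat * bool)) thr w : bool :=
  if feat w is Some F then F.2 != cut_above thr F.1 else false.

Section FlatWords.

Variables (p q r : nat) (feat : seq (nat * nat) -> option (nat * bool)).
Variable v : nat -> seq (nat * nat).
Hypothesis r_gt0 : 0 < r.
Hypothesis moved_v : forall k, 1 <= k <= 2 * r -> moved p (v k) /\ moved q (v k).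
Hypothesis inj_v : forall k l, 1 <= k <= 2 * r -> 1 <= l <= 2 * r -> v k = v l -> k = l.
Hypothesis fixed_v : forall j, 2 <= j <= r -> phi_at 1 (v (2 * j - 1)) = v (2 * j - 1).
Hypothesis step_q : forall j, 1 <= j <= r -> phi_at q (v (2 * j - 1)) = v (2 * j).
Hypothesis step_p : forall j, 1 <= j <= r - 1 -> exists t,
  v (2 * j + 1) = iter t (fun x => phi_at p (phi_at 1 x)) (phi_at p (v (2 * j))).

Let acc j := rev [seq v k | k <- iota 1 (2 * j)].

Let acc_cons j : acc j.+1 = [:: v (2 * j + 2), v (2 * j + 1) & acc j].
Proof.
rewrite /acc (_ : 2 * j.+1 = 2 * j + 2); last lia.
by rewrite iotaD map_cat rev_cat add1n addn1 addn2.
Qed.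

(** The given flat chain is one of the branches of the search: by induction on j, a successful
    search passes through its first 2j words, and there it has tested [flat_ok]. *)
Lemma explore_flat : flat_from p q feat (v 1) ->
  flat_ok (pmap feat [seq v k | k <- iota 1 (2 * r)]).
Proof.
move=> flat1.
have ex_explore j : 1 <= j <= r -> exists f, explore p q feat f (acc j).
  elim: j => // -[_ _|j IHj j_r].
    exists 4; rewrite acc_cons; have v2 : phi_at q (v 1) = v 2 by apply: (step_q (j := 1)).
    have [mp _] : moved p (v 1) /\ moved q (v 1) by apply: moved_v; lia.
    have [mp2 _] : moved p (v 2) /\ moved q (v 2) by apply: moved_v; lia.
    move: flat1; rewrite /flat_from mp v2 word_eqbE mp2.
    by rewrite (_ : (v 2 == v 1) = false) //; apply/negP => /eqP/inj_v; lia.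
  have [|f] := IHj; first lia.
  have accj : acc j.+1 = v (2 * j.+1) :: behead (acc j.+1).
    by rewrite acc_cons /=; congr (v _ :: _); lia.
  case: f => [|f]; rewrite /explore -/explore; case: ifP => // _.
  rewrite accj; case orb: (orbit_from _ _ _ _) => [s|//] /allP s_ok.
  have [|t vt] := step_p (j := j.+1); first lia.
  have := s_ok (v (2 * j.+1 + 1)); rewrite {1}vt => /(_ (orbit_fromP t orb)).
  rewrite -accj; set y := v (2 * j.+1 + 1).
  have yE : y = v (2 * j.+2 - 1) by congr v; lia.
  have y'E : phi_at q y = v (2 * j.+1 + 2).
    by rewrite yE step_q; [congr v; lia | lia].
  have n1 : moved 1 y = false by rewrite /moved word_eqbE yE fixed_v ?eqxx //; lia.
  have [mp _] : moved p y /\ moved q y by apply: moved_v; lia.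
  have [mp' _] : moved p (v (2 * j.+1 + 2)) /\ moved q (v (2 * j.+1 + 2)).
    by apply: moved_v; lia.
  rewrite n1 mp y'E mp' word_eqbE.
  have nacc k : 2 * j.+1 < k <= 2 * r -> has (word_eqb (v k)) (acc j.+1) = false.
    move=> kr; apply/negP => /hasP[x]; rewrite mem_rev => /mapP[l + ->].
    rewrite mem_iota word_eqbE => lj /eqP/inj_v; lia.
  rewrite !nacc; try lia.
  rewrite (_ : (v (2 * j.+1 + 2) == y) = false); last by apply/negP => /eqP/inj_v; lia.
  by rewrite -acc_cons => ex; exists f.
have [|f] := ex_explore r; first lia.
rewrite -[X in pmap feat X]revK -/(acc r).
by case: f => [|f]; rewrite /explore -/explore; case: ifP.
Qed.

Lemma flat_words thr : (forall k, 1 <= k <= 2 * r -> feat (v k)) ->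
  flat_from p q feat (v 1) -> forall j, 1 < j < r ->
  unfixed_at feat thr (v (2 * j - 1)) -> unfixed_at feat thr (v (2 * j)) ->
  (forall k, 1 <= k <= 2 * j -> unfixed_at feat thr (v k)) \/
  (forall k, 2 * j - 1 <= k <= 2 * r -> unfixed_at feat thr (v k)).
Proof.
move=> feat_v /explore_flat ok j jr U1 U2.
set F := pmap feat _ in ok.
have [cut cut_in cutE] := cut_exists F thr.
have := allP ok cut cut_in; rewrite cutE.
have -> : cut_pattern F thr = [seq unfixed_at feat thr (v k) | k <- iota 1 (2 * r)].
  rewrite /F; have : forall k, k \in iota 1 (2 * r) -> feat (v k).
    by move=> k; rewrite mem_iota => kr; apply: feat_v; lia.
  elim: (iota _ _) => //= k s IHs feat_s.
  have := feat_s k (mem_head _ _); rewrite /unfixed_at.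
  case: (feat (v k)) => [f|//] _ /=; congr (_ :: _); apply: IHs => l ls.
  by apply: feat_s; rewrite inE ls orbT.
rewrite /pattern_ok size_map size_iota => /allP/(_ j).
rewrite mem_iota (_ : (2 * r)./2 = r); last by rewrite mul2n doubleK.
move=> /(_ ltac:(lia)).
have nthE k : k < 2 * r -> nth true [seq unfixed_at feat thr (v k) | k <- iota 1 (2 * r)] k =
    unfixed_at feat thr (v k.+1).
  by move=> kr; rewrite (nth_map 0) ?size_iota // nth_iota.
rewrite !nthE; try lia.
rewrite (_ : (2 * j - 2).+1 = 2 * j - 1) ?U1; last lia.
rewrite (_ : (2 * j - 1).+1 = 2 * j) ?U2; last lia.
case/orP=> /(all_nthP true) U; [left|right] => k kr.
  have := U k.-1; rewrite size_takel ?size_map ?size_iota; last lia.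
  move=> /(_ ltac:(lia)); rewrite nth_take; last lia.
  by rewrite nthE ?prednK //; lia.
have := U (k - (2 * j - 2) - 1); rewrite size_drop size_map size_iota nth_drop.
move=> /(_ ltac:(lia)); rewrite nthE; last lia.
by rewrite (_ : _.+1 = k) //; lia.
Qed.

End FlatWords.

Section FlatChains.

Variables (z : nat -> nat) (n : nat).
Hypotheses (Sz : Sinf z) (rank_z : has_rank z n).

Local Notation C := (chains z n).

(* A flat chain moves only five consecutive entries. The condition also depends on a
   sixth one, but only through the comparison of its label with the label of its
   neighbour; this is encoded by [thr]. *)
Lemma flat_chain_window (ph : nat -> seq (nat * nat) -> seq (nat * nat)) p q
    (feat : seq (nat * nat) -> option (nat * bool)) (thr : option nat) i r
    (c : nat -> seq (nat * nat)) (s s' w : seq (nat * nat)) :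
  p + 3 <= 5 -> q + 3 <= 5 ->
  c 1 = s ++ w ++ s' -> size w = 5 ->
  (forall u, size u = 5 -> feat u) -> flat_from p q feat w ->
  (forall u, size u = 5 -> C (s ++ u ++ s') ->
    [/\ ph (i - 2) (s ++ u ++ s') = s ++ phi_at p u ++ s',
        ph (i - 1) (s ++ u ++ s') = s ++ phi_at 1 u ++ s',
        ph i (s ++ u ++ s') = s ++ phi_at q u ++ s' &
        ph i.+1 (s ++ u ++ s') <> s ++ u ++ s' <-> unfixed_at feat thr u]) ->
  flat_chain C ph i r c ->
  forall j, 1 < j < r ->
    ph i.+1 (c (2 * j - 1)) <> c (2 * j - 1) ->
    ph i.+1 (c (2 * j)) <> c (2 * j) ->
    (forall k, 1 <= k <= 2 * j -> ph i.+1 (c k) <> c k) \/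
    (forall k, 2 * j - 1 <= k <= 2 * r -> ph i.+1 (c k) <> c k).
Proof.
move=> p5 q5 c1 sw feat5 flat_w phE [cC c_inj c_fix c_q c_p] j jr.
set emb := fun u => s ++ u ++ s'.
have emb_inj u u' : size u = 5 -> size u' = 5 -> emb u = emb u' -> u = u'.
  move=> su su' /eqP; rewrite /emb eqseq_cat // eqxx /= eqseq_cat ?su ?su' //.
  by case/andP=> /eqP.
have chain_emb k u : 1 <= k <= 2 * r -> c k = emb u -> C (emb u).
  by move=> kr <-; case: (cC k kr).
have iter_emb t u : size u = 5 -> C (emb u) ->
    let u' := iter t (fun x => phi_at p (phi_at 1 x)) u in
    [/\ size u' = 5, C (emb u') &
        iter t (fun x => ph (i - 2) (ph (i - 1) x)) (emb u) = emb u'].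
  move=> su Cu; elim: t => //= t [su' Cu' ->].
  have [_ -> _ _] := phE _ su' Cu'; set u' := iter _ _ _ in su' Cu' *.
  have C1 : C (emb (phi_at 1 u')).
    have := chains_phi_at Sz rank_z (size s + 1) Cu'.
    by rewrite /emb phi_at_cat ?su'.
  have s1 : size (phi_at 1 u') = 5 by rewrite size_phi_at.
  have [-> _ _ _] := phE _ s1 C1; rewrite !size_phi_at; split=> //.
  have := chains_phi_at Sz rank_z (size s + p) C1.
  by rewrite /emb phi_at_cat ?s1.
pose v k := take 5 (drop (size s) (c k)).
have takeE u : size u = 5 -> take 5 (drop (size s) (emb u)) = u.
  by move=> su; rewrite /emb drop_size_cat // take_size_cat.
(* All elements keep the prefix [s] and the suffix [s'], since each pair arises from the preceding
   one by involutions acting inside the window. *)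
have emb_v m : 1 <= m <= r -> [/\ c (2 * m - 1) = emb (v (2 * m - 1)),
    c (2 * m) = emb (v (2 * m)), size (v (2 * m - 1)) = 5, size (v (2 * m)) = 5 &
    phi_at q (v (2 * m - 1)) = v (2 * m)].
  have half k u : 1 <= k <= r -> size u = 5 -> c (2 * k - 1) = emb u ->
      [/\ c (2 * k - 1) = emb (v (2 * k - 1)), c (2 * k) = emb (v (2 * k)),
      size (v (2 * k - 1)) = 5, size (v (2 * k)) = 5 &
      phi_at q (v (2 * k - 1)) = v (2 * k)].
    move=> kr su ck; have Cu : C (emb u) by apply: chain_emb ck; lia.
    have [_ _ phq _] := phE _ su Cu.
    have ck' : c (2 * k) = emb (phi_at q u) by rewrite -c_q // ck phq.
    have sq : size (phi_at q u) = 5 by rewrite size_phi_at.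
    by rewrite /v ck ck' (takeE u su) (takeE _ sq); split.
  elim: m => // -[_ _|m IHm mr]; first by apply: (half 1 w) => //; lia.
  have [|_ c2 _ s2 _] := IHm; first lia.
  have [|t] := c_p m.+1; first lia.
  rewrite c2; have C2 : C (emb (v (2 * m.+1))) by apply: (chain_emb _ _ _ c2); lia.
  have [-> _ _ _] := phE _ s2 C2.
  have C2' : C (emb (phi_at p (v (2 * m.+1)))).
    by have := chains_phi_at Sz rank_z (size s + p) C2; rewrite /emb phi_at_cat ?s2.
  have [|su _ ->] := iter_emb t _ _ C2'; first by rewrite size_phi_at.
  move=> cE; apply: (half m.+2 _ mr su); rewrite -cE; congr c; lia.
have emb_vk k : 1 <= k <= 2 * r -> c k = emb (v k) /\ size (v k) = 5.
  move=> kr; have kE := odd_double_half k.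
  have [|e1 e2 e3 e4 _] := emb_v (k.+1)./2.
    by have := odd_double_half k.+1; rewrite /=; case: odd; lia.
  have [ek|ek] : k = 2 * (k.+1)./2 - 1 \/ k = 2 * (k.+1)./2.
    by have := odd_double_half k.+1; rewrite /=; case: odd; lia.
  - by rewrite ek.
  by rewrite ek.
have vC k : 1 <= k <= 2 * r -> C (emb (v k)).
  by move=> kr; have [ck _] := emb_vk k kr; apply: chain_emb ck.
have unfixedE k : 1 <= k <= 2 * r -> ph i.+1 (c k) <> c k <-> unfixed_at feat thr (v k).
  move=> kr; have [-> sk] := emb_vk k kr.
  by have [_ _ _ ->] := phE _ sk (vC k kr).
have r0 : 0 < r by lia.
move=> /unfixedE U1 /unfixedE U2.
have v1 : v 1 = w by rewrite /v c1 takeE.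
have := @flat_words p q r feat v r0 _ _ _ _ _ thr _ _ j jr.
case.
- move=> k kr; have [ck sk] := emb_vk k kr; have [_ n1 n2] := cC k kr.
  have [pE _ qE _] := phE _ sk (vC k kr).
  split; apply/movedP => e; [apply: n1 | apply: n2]; rewrite ck ?pE ?qE e //.
- move=> k l kr lr e; apply: c_inj => //.
  by have [-> _] := emb_vk k kr; have [-> _] := emb_vk l lr; rewrite e.
- move=> m mr; have kr : 1 <= 2 * m - 1 <= 2 * r by lia.
  have [ck sk] := emb_vk _ kr; have [_ oneE _ _] := phE _ sk (vC _ kr).
  apply: emb_inj; rewrite ?size_phi_at //.
  by have := c_fix m mr; rewrite ck oneE.
- by move=> m /emb_v[].
- move=> m mr; have [t ct] := c_p m mr; exists t.
  have kr : 1 <= 2 * m <= 2 * r by lia.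
  have kr' : 1 <= 2 * m + 1 <= 2 * r by lia.
  have [ck sk] := emb_vk _ kr; have [ck' sk'] := emb_vk _ kr'.
  have [pE _ _ _] := phE _ sk (vC _ kr).
  have C2' : C (emb (phi_at p (v (2 * m)))).
    have := chains_phi_at Sz rank_z (size s + p) (vC _ kr).
    by rewrite /emb phi_at_cat ?sk.
  have [|su _ iterE] := iter_emb t _ _ C2'; first by rewrite size_phi_at.
  by apply: emb_inj => //; rewrite -ck' ct ck pE iterE.
- by move=> k kr; have [_ sk] := emb_vk k kr; exact: feat5.
- by rewrite v1.
- by apply: U1; lia.
- by apply: U2; lia.
- by move=> U; left => k kr; apply/unfixedE; [lia | exact: U].
by move=> U; right => k kr; apply/unfixedE; [lia | exact: U].
Qed.

Lemma chain_phi_neq i c : 2 <= i <= n - 1 -> C c ->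
  chain_phi i c <> c <->
  nth false (des_bits c) (i - 2) != nth false (des_bits c) (i - 1).
Proof.
move=> i_n Cc; have := chains_axiom_i Sz rank_z i_n Cc; rewrite !chain_DesE.
have [-> ->] : (i - 1).-1 = i - 2 /\ i.-1 = i - 1 by lia.
have [-> ->] : 0 < i - 1 /\ 0 < i by lia.
by case: (nth _ _ (i - 2)); case: (nth _ _ (i - 1)); intuition.
Qed.

Lemma chains_axiom_ivc : axiom_ivc n C chain_phi.
Proof.
have feat_last5 u : size u = 5 -> feat_last u.
  by case: u => [|? [|? [|? [|? [|? [|? ?]]]]]].
have feat_first5 u : size u = 5 -> feat_first u.
  by case: u => [|? [|? [|? [|? [|? [|? ?]]]]]].
split=> i r c i_n flat_c j jr; have [cC _ _ _ _] := flat_c.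
  have C1 : C (c 1) by case: (cC 1) => //; lia.
  (* The entries i-3 to i+1, on which phi_(i-2), phi_(i-1) and phi_i act; entry i+2 exists because
     [i < n - 1]. *)
  have [|s [w [s' [cE ss sw w_gb]]]] := @chains_window z n Sz rank_z (i - 4) 5 (c 1) C1.
    by lia.
  have [_ _ flat_w _] := check5P (gb_word_check5 w_gb sw).
  have ss' : 0 < size s'.
    have /(chainsP Sz rank_z)[sc _ _] := C1.
    by move: sc; rewrite cE !size_cat ss sw; lia.
  case: s' ss' cE => // t s' _ cE.
  apply: (@flat_chain_window _ 0 2 feat_last (Some t.2) i r c s (t :: s') w) => //.
  move=> u su Cu; have e0 : i - 2 = size s + 2 + 0 by lia.
  have e1 : i - 1 = size s + 2 + 1 by lia.
  have e2 : i = size s + 2 + 2 by lia.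
  split.
  - by rewrite e0 (chain_phi_window Sz rank_z) ?su.
  - by rewrite e1 (chain_phi_window Sz rank_z) ?su.
  - by rewrite {1}e2 (chain_phi_window Sz rank_z) ?su.
  have i1_n : 2 <= i.+1 <= n - 1 by lia.
  rewrite (chain_phi_neq i1_n Cu).
  have [-> ->] : i.+1 - 2 = size s + 3 /\ i.+1 - 1 = size s + 4 by lia.
  case: u su {Cu} => [|u1 [|u2 [|u3 [|u4 [|u5 [|? ?]]]]]] // _.
  rewrite -[[:: u1; u2; u3; u4; u5] ++ t :: s']/([:: u1; u2; u3; u4; u5; t] ++ s').
  by rewrite !nth_des_bits_cat.
have C1 : C (c 1) by case: (cC 1) => //; lia.
(* The mirror image: the window is n-i to n-i+4, and entry n-i-1 before it is the constant neighbour
   read by phi_(n-i), the reversed phi_(i+1). *)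
have [|s0 [w0 [s' [cE ss0 sw0 w0_gb]]]] := @chains_window z n Sz rank_z (n - i - 2) 6 (c 1) C1.
  by lia.
case: w0 sw0 w0_gb cE => // t w [sw] w0_gb cE.
have w_gb : gb_word w by apply: (@gb_word_factor [:: t] w [::]); rewrite cats0.
have [_ _ _ flat_w] := check5P (gb_word_check5 w_gb sw).
have {}cE : c 1 = (rcons s0 t) ++ w ++ s' by rewrite cE -cats1 -catA.
(* The absence of a descent from [t] to u is [t.2 <= u.2], which is B < u.2 when [t.2] is B + 1 and
   always true when [t.2] is 0. *)
pose thr := if t.2 is B.+1 then Some B else None.
apply: (@flat_chain_window (fun x => chain_phi (n + 1 - x)) 2 0 feat_first thr
  i r c (rcons s0 t) s' w) => //.
move=> u su Cu.
have e0 : n + 1 - (i - 2) = size (rcons s0 t) + 2 + 2 by rewrite size_rcons; lia.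
have e1 : n + 1 - (i - 1) = size (rcons s0 t) + 2 + 1 by rewrite size_rcons; lia.
have e2 : n + 1 - i = size (rcons s0 t) + 2 + 0 by rewrite size_rcons; lia.
split.
- by rewrite e0 (chain_phi_window Sz rank_z) ?su.
- by rewrite e1 (chain_phi_window Sz rank_z) ?su.
- by rewrite e2 (chain_phi_window Sz rank_z) ?su.
have i1_n : 2 <= n + 1 - i.+1 <= n - 1 by lia.
rewrite (chain_phi_neq i1_n Cu).
have [-> ->] : n + 1 - i.+1 - 2 = size s0 + 0 /\ n + 1 - i.+1 - 1 = size s0 + 1 by lia.
case: u su {Cu} => [|u1 [|u2 [|u3 [|u4 [|u5 [|? ?]]]]]] // _.
rewrite -cats1 -catA.
rewrite -[[:: t] ++ _ ++ s']/([:: t; u1; u2; u3; u4; u5] ++ s') !nth_des_bits_cat //=.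
have cutE : cut_above thr u1.2 = ~~ desb t u1.
  rewrite /desb /thr nat_ltbE -leqNgt; case: (t.2) => [|B] //=.
  by rewrite nat_ltbE.
by rewrite /unfixed_at /= cutE; case: desb; case: desb.
Qed.

End FlatChains.

Theorem theorem2p5 (z : nat -> nat) (n : nat) (hz : Sinf z) (hn : has_rank z n) :
  dual_equivalence n (chains z n) chain_Des chain_phi.
Proof.
split; split.
- exact: chains_setting.
- exact: chains_axiom_i.
- exact: chains_axiom_ii.
- exact: chains_axiom_iii.
- exact: chains_axiom_iva.
- exact: chains_axiom_ivb.
exact: chains_axiom_ivc.
Qed.
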